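(* There exists a minimal $4$-interval exchange transformation $T\colon[0,1)\to[0,1)$ and a number $b\in[\tfrac14,\tfrac34]$ such that the function $\phi_1(x,y)=\liminf_{n\to\infty} n\,|T^n(x)-y|$ satisfies: $\phi_1(x,y)\in\{0,\infty\}$ for $\lambda\times\lambda$-a.e. $(x,y)$, and $(\lambda\times\lambda)(\{(x,y):\phi_1(x,y)=0\})=b$, where $\lambda$ is Lebesgue measure on $[0,1)$.
   Context: An $r$-interval exchange transformation (IET) is given by a permutation $\pi$ of $\{1,\dots,r\}$ and a vector $(\ell_1,\dots,\ell_r)$ with all $\ell_i>0$ and $\sum\ell_i=1$: with $s_0=0$, $s_k=\sum_{i\le k}\ell_i$ and $I_k=[s_{k-1},s_k)$, one sets $T(x)=x-\sum_{i<k}\ell_i+\sum_{\pi(i')<\pi(k)}\ell_{i'}$ for $x\in I_k$. $T$ is minimal if every orbit is dense in $[0,1)$. *)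

(* Defs.v *)
From HB Require Import structures.
From mathcomp Require Import all_boot all_order all_algebra all_fingroup.
From mathcomp Require Import all_classical all_reals all_analysis.
Set Implicit Arguments. Unset Strict Implicit. Unset Printing Implicit Defensive.
Import Order.TTheory GRing.Theory Num.Theory.
Local Open Scope ring_scope.

(* Intervals indexed 0..r-1 (paper: 1..r).  s_k = sum_{i<k} l_i,
   I_k = [s_k, s_{k+1}). *)
Definition iet_s {R : realType} (r : nat) (l : 'I_r -> R) (k : nat) : R :=
  \sum_(i < r | (i < k)%N) l i.

(* The interval exchange transformation T with permutation pi and lengths l:
   for x in I_k, T x = x - sum_{i<k} l_i + sum_{pi i' < pi k} l_{i'}.
   (Outside [0,1) T is the identity; this is irrelevant.) *)
Definition iet {R : realType} (r : nat) (pi : 'S_r) (l : 'I_r -> R) (x : R) : R :=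
  x + \sum_(k < r)
        (if (iet_s l k <= x) && (x < iet_s l k.+1)
         then - iet_s l k + \sum_(i < r | (pi i < pi k)%N) l i
         else 0).

Definition iet_lengths {R : realType} (r : nat) (l : 'I_r -> R) : Prop :=
  (forall i, 0 < l i) /\ \sum_(i < r) l i = 1.

Definition minimal_map {R : realType} (T : R -> R) : Prop :=
  forall x y : R, 0 <= x < 1 -> 0 <= y < 1 ->
    forall e : R, 0 < e -> exists n : nat, `|iter n T x - y| < e.

Definition phi1 {R : realType} (T : R -> R) (x y : R) : \bar R :=
  limn_einf (fun n : nat => ((n%:R : R) * `|iter n T x - y|)%:E).

Definition unit_square {R : realType} : set (R * R) :=
  [set p | (0 <= p.1 < 1) /\ (0 <= p.2 < 1)].

(* Main.v *)
(** We build a minimal 4-IET (in the spirit of Keane's non-ergodic examples) whose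
    orbits follow, up to null sets, one of two families of Rokhlin towers.

    With bottom order 2 4 1 3 the intervals [I_2] and [I_3] are moved by the tiny
    steps [-l_1] and [+l_4], so a point stays for a long time in the tower over
    either of them.  First return to [J = T(I_1 u I_4)] (slightly shortened) gives
    an exchange of the same type: the new second tower makes [m] turns around the
    old second tower, then [n] turns around the old third one, and the new third
    tower makes [m + 1] turns around the old second one.  Choosing [m, n] so fast growing that
    [m] dominates the previous heights and [n] dominates [m] times them, the towers
    form two lineages (which swap places 2 and 3 at each stage); the points
    eventually in lineage [s] form a set of measure 1/2.

    If [x] and [y] are in the same lineage, the orbit of [x] sweeps the level of
    [y] with step [dl], and hits a fixed proportion of this level at times [n] with
    [n |T^n x - y|] small, infinitely often over the stages; Lebesgue density then
    gives [phi_1 = 0] a.e.  If they are in different lineages, then up to the stay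
    time of a stage the orbit of [x] is in levels not containing [y], so that
    closeness forces [y] to be near the end of one of few levels; this is excluded
    eventually by Borel-Cantelli, and [phi_1 = oo].  Hence b = 1/2. *)
Require Import Defs.
From HB Require Import structures.
From mathcomp Require Import all_boot all_order all_algebra all_fingroup.
From mathcomp Require Import all_classical all_reals all_analysis.
From mathcomp Require Import measurable_realfun ring lra zify.
Set Implicit Arguments. Unset Strict Implicit. Unset Printing Implicit Defensive.
Import Order.TTheory GRing.Theory Num.Theory numFieldNormedType.Exports.
Local Open Scope classical_set_scope.
Local Open Scope ring_scope.

(** * Towers and one step of renormalisation *)

Section Towers.
Context {R : realType} (T : R -> R).

(** The window [[lo], [hi]) is avoided only at times strictly between 0 and [h]. Nothing is asked of
    the landing interval, so pieces landing outside the window can be concatenated. *)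
Definition tower (lo hi c w : R) (h : nat) (tau : R) : Prop :=
  forall x, c <= x < c + w ->
    [/\ iter h T x = x + tau,
        forall i, (i <= h)%N -> iter i T x - x = iter i T c - c &
        forall i, (0 < i < h)%N -> ~~ (lo <= iter i T x < hi)].

Lemma tower_sub lo hi c w h tau lo' hi' c' w' :
  lo <= lo' -> hi' <= hi -> c <= c' -> c' + w' <= c + w ->
  tower lo hi c w h tau -> tower lo' hi' c' w' h tau.
Proof.
move=> llo hhi cc cw H x /andP[cx xc].
have xI : c <= x < c + w by apply/andP; split; lra.
have cI : c <= c' < c + w by apply/andP; split; lra.
have [Hx1 Hx2 Hx3] := H _ xI; have [_ Hc2 _] := H _ cI; split=> //.
  by move=> i ih; rewrite Hx2 // Hc2.
move=> i ih; apply/negP => /andP[A B]; move/negP: (Hx3 i ih); apply.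
by apply/andP; split; lra.
Qed.

(** Time [h1] is interior to the concatenation but an endpoint of both pieces, whence the condition
    that the intermediate interval misses the window. *)
Lemma tower_cat {lo hi c w h1 t1 h2 t2} :
  tower lo hi c w h1 t1 -> tower lo hi (c + t1) w h2 t2 ->
  c + t1 + w <= lo \/ hi <= c + t1 ->
  tower lo hi c w (h1 + h2) (t1 + t2).
Proof.
move=> H1 H2 out x xI.
have cI : c <= c < c + w by case/andP: xI => cx xc; apply/andP; split; lra.
have [A1 A2 A3] := H1 _ xI; have [C1 C2 C3] := H1 _ cI.
have x'I : c + t1 <= x + t1 < c + t1 + w.
  by case/andP: xI => cx xc; apply/andP; split; lra.
have [B1 B2 B3] := H2 _ x'I.
have iterE i y : iter (i + h1) T y = iter i T (iter h1 T y) by rewrite iterD.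
split.
- by rewrite addnC iterE A1 B1 addrA.
- move=> i ih; case: (leqP i h1) => [/A2 //|h1i].
  have -> : i = ((i - h1) + h1)%N by rewrite subnK // ltnW.
  rewrite !iterE A1 C1; have := B2 (i - h1)%N; rewrite leq_subLR => /(_ ih) E.
  lra.
- move=> i /andP[i0 ih]; case: (ltngtP i h1) => [ih1|h1i|->].
  + by apply: A3; rewrite i0.
  + have -> : i = ((i - h1) + h1)%N by rewrite subnK // ltnW.
    by rewrite iterE A1; apply: B3; lia.
  + rewrite A1; apply/negP => /andP[y1 y2]; case/andP: x'I => z1 z2.
    by case: out => ?; lra.
Qed.

Lemma tower0 lo hi c w : tower lo hi c w 0 0.
Proof.
move=> x _; split; first by rewrite addr0.
- by move=> i; rewrite leqn0 => /eqP ->; rewrite /= !subrr.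
- by move=> i; rewrite ltn0 andbF.
Qed.

Lemma tower_iter lo hi c w h d lo' hi' c' w' (r : nat) :
  lo <= lo' -> hi' <= hi ->
  (forall j : nat, (j < r)%N -> c <= c' + j%:R * d /\ c' + j%:R * d + w' <= c + w) ->
  (forall j : nat, (0 < j < r)%N -> c' + j%:R * d + w' <= lo' \/ hi' <= c' + j%:R * d) ->
  tower lo hi c w h d -> tower lo' hi' c' w' (r * h) (r%:R * d).
Proof.
move=> llo hhi Hin Hout H; elim: r Hin Hout => [|r IH] Hin Hout.
  by rewrite mul0n mul0r; exact: tower0.
rewrite mulSn addnC mulrSr mulrDl mul1r.
case: r IH Hin Hout => [|r] IH Hin Hout.
  rewrite mul0n mul0r add0r add0n; have [A B] := Hin 0%N isT.
  rewrite mul0r addr0 in A B; exact: tower_sub H.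
apply: tower_cat.
- by apply: IH => j jr; [apply: Hin; lia | apply: Hout; lia].
- by have [A B] := Hin r.+1 (ltnSn _); exact: tower_sub H.
- by apply: Hout; rewrite /= ltnSn.
Qed.

(** The drift is monotone, so two checks suffice: the first landing already clears the window, and
    the last turn still starts in the base. *)
Lemma tower_left lo hi c w h d lo' hi' c' w' (r : nat) :
  0 <= d -> lo <= lo' -> hi' <= hi ->
  c' + w' <= c + w -> c <= c' - r%:R * d + d ->
  c' - d + w' <= lo' ->
  tower lo hi c w h (- d) -> tower lo' hi' c' w' (r * h) (- (r%:R * d)).
Proof.
move=> d0 llo hhi cw cc ll H; rewrite -mulrN.
apply: (tower_iter _ _ _ _ H) => // j jr.
  have : j%:R * d <= r%:R * d - d.
    by rewrite -[X in _ - X]mul1r -mulrBl ler_wpM2r // lerBrDr natr1 ler_nat; lia.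
  have : 0 <= j%:R * d by rewrite mulr_ge0.
  by rewrite mulrN; split; lra.
have : d <= j%:R * d by rewrite ler_peMl // ler1n; lia.
by rewrite mulrN; left; lra.
Qed.

Lemma tower_right lo hi c w h d lo' hi' c' w' (r : nat) :
  0 <= d -> lo <= lo' -> hi' <= hi ->
  c <= c' -> c' + r%:R * d - d + w' <= c + w ->
  hi' <= c' + d ->
  tower lo hi c w h d -> tower lo' hi' c' w' (r * h) (r%:R * d).
Proof.
move=> d0 llo hhi cw cc ll H.
apply: (tower_iter _ _ _ _ H) => // j jr.
  have : j%:R * d <= r%:R * d - d.
    by rewrite -[X in _ - X]mul1r -mulrBl ler_wpM2r // lerBrDr natr1 ler_nat; lia.
  have : 0 <= j%:R * d by rewrite mulr_ge0.
  by split; lra.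
have : d <= j%:R * d by rewrite ler_peMl // ler1n; lia.
by right; lra.
Qed.

(* First return to [a, a + l1 + l2 + l3 + l4) is an exchange with bottom order
   2 4 1 3; [h1, ..., h4] are the return times. *)
Definition stage (a l1 l2 l3 l4 : R) (h1 h2 h3 h4 : nat) : Prop :=
  let b := a + (l1 + l2 + l3 + l4) in
  [/\ tower a b a l1 h1 (l2 + l4),
      tower a b (a + l1) l2 h2 (- l1),
      tower a b (a + l1 + l2) l3 h3 l4 &
      tower a b (a + l1 + l2 + l3) l4 h4 (- (l1 + l3))].

(** Renormalisation read backwards, from new lengths to old ones. The remainders decide the numbers
    of turns: [k3] is left of [l2] after [m] steps [l1], and [k1 + k4] is left of [l3] after [n]
    steps [l4]. *)
Definition refines (m n : nat) (l1 l2 l3 l4 k1 k2 k3 k4 : R) : Prop :=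
  [/\ [/\ 0 < k1, 0 < k2, 0 < k3 & 0 < k4],
      l1 = k1 + k2 + k3, l2 = m%:R * l1 + k3,
      l3 = n%:R * l4 + k1 + k4 & l4 = k1 + k2 + k4].

Section Step.
Variables (a l1 l2 l3 l4 k1 k2 k3 k4 : R) (h1 h2 h3 h4 m n : nat).
Hypotheses (m_gt0 : (0 < m)%N) (n_gt0 : (0 < n)%N).
Hypothesis lk : refines m n l1 l2 l3 l4 k1 k2 k3 k4.
Hypothesis st : stage a l1 l2 l3 l4 h1 h2 h3 h4.

(** The point [a' + l1] separates the old second and third intervals: the new intervals 1 to 3 fill
    the last [l1] of the former, and the new fourth one begins the latter. *)
Let a' := a + l2.
Let b' := a' + (k1 + k2 + k3 + k4).

Let ml1_ge : l1 <= m%:R * l1.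
Proof. by case: lk => -[? ? ? ?] ? ? ? ?; apply: ler_peMl; [lra | rewrite ler1n]. Qed.
Let nl4_ge : l4 <= n%:R * l4.
Proof. by case: lk => -[? ? ? ?] ? ? ? ?; apply: ler_peMl; [lra | rewrite ler1n]. Qed.

Let t1 : tower a' b' a l1 h1 (l2 + l4).
Proof.
have := ml1_ge; have := nl4_ge; case: lk => -[? ? ? ?] ? ? ? ? ? ?.
by case: st => H _ _ _; apply: tower_sub H; rewrite /b' /a'; lra.
Qed.
Let t4 : tower a' b' (a + l1 + l2 + l3) l4 h4 (- (l1 + l3)).
Proof.
have := ml1_ge; have := nl4_ge; case: lk => -[? ? ? ?] ? ? ? ? ? ?.
by case: st => _ _ _ H; apply: tower_sub H; rewrite /b' /a'; lra.
Qed.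

(* From the bottom part of the new base: [r] steps to the left in the second
   interval, then the jump of the first one. *)
Lemma down_and_across c w (r : nat) :
  (r = m /\ a' <= c /\ c + w <= a' + k1 + k2) \/
  (r = m.+1 /\ a' + k1 + k2 <= c /\ c + w <= a' + l1) ->
  0 < w ->
  tower a' b' c w (r * h2 + h1) (- (r%:R * l1) + (l2 + l4)).
Proof.
have := ml1_ge; have := nl4_ge; case: lk => -[? ? ? ?] ? ? ? ? ? ?.
move=> Hr w0; apply: tower_cat.
- case: st => _ H _ _; apply: tower_left H; rewrite /b' /a';
  by case: Hr => -[rE]; subst r; rewrite /a' -?natr1 => -[? ?]; lra.
- apply: (tower_sub _ _ _ _ t1); rewrite //;
  by case: Hr => -[rE]; subst r; rewrite /a' -?natr1 => -[? ?]; lra.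
- by left; case: Hr => -[rE]; subst r; rewrite /b' /a' -?natr1 => -[? ?]; lra.
Qed.

(** Since [l3 = n * l4 + k1 + k4], points at distance less than [k1 + k4] from the left end of the
    third interval leave it after [n + 1] steps to the right, the following ones after [n]; then
    comes the jump of the fourth interval. *)
Lemma up_and_back c w (r : nat) :
  (r = n.+1 /\ a' + l1 <= c /\ c + w <= a' + l1 + k1 + k4) \/
  (r = n /\ a' + l1 + k1 + k4 <= c /\ c + w <= a' + l1 + l4) ->
  0 < w ->
  tower a' b' c w (r * h3 + h4) (r%:R * l4 - (l1 + l3)).
Proof.
have := ml1_ge; have := nl4_ge; case: lk => -[? ? ? ?] ? ? ? ? ? ?.
move=> Hr w0; apply: tower_cat.
- case: st => _ _ H _; apply: tower_right H; rewrite /b' /a';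
  by case: Hr => -[rE]; subst r; rewrite /a' -?natr1 => -[? ?]; lra.
- apply: (tower_sub _ _ _ _ t4); rewrite //;
  by case: Hr => -[rE]; subst r; rewrite /a' -?natr1 => -[? ?]; lra.
- by right; case: Hr => -[rE]; subst r; rewrite /b' /a' -?natr1 => -[? ?]; lra.
Qed.

(** [down_and_across] sends the new intervals 1 and 2 just to the right of the new base, at offsets
    [k4] and [k4 + k1] in the old third interval; [up_and_back] brings them home after [n + 1] and
    [n] turns. The new interval 3 returns by the first move alone, the new interval 4 by the second
    alone. *)
Lemma stage_step :
  stage (a + l2) k1 k2 k3 k4
    (m * h2 + h1 + (n.+1 * h3 + h4)) (m * h2 + h1 + (n * h3 + h4))
    (m.+1 * h2 + h1) (n.+1 * h3 + h4).
Proof.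
have := ml1_ge; have := nl4_ge; case: lk => -[? ? ? ?] ? ? ? ? ? ?.
rewrite /stage -/a' -/b'; split.
- have -> : k2 + k4 = (- (m%:R * l1) + (l2 + l4)) + (n.+1%:R * l4 - (l1 + l3)).
    by rewrite -natr1; lra.
  apply: tower_cat.
  + by apply: down_and_across => //; left; split=> //; split; rewrite ?/a'; lra.
  + by apply: up_and_back => //; left; split=> //; split; rewrite ?/a'; lra.
  + by right; rewrite /b'; lra.
- have -> : - k1 = (- (m%:R * l1) + (l2 + l4)) + (n%:R * l4 - (l1 + l3)).
    by lra.
  apply: tower_cat.
  + by apply: down_and_across => //; left; split=> //; split; rewrite ?/a'; lra.
  + by apply: up_and_back => //; right; split=> //; split; rewrite ?/a'; lra.
  + by right; rewrite /b'; lra.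
- have -> : k4 = - (m.+1%:R * l1) + (l2 + l4) by rewrite -natr1; lra.
  by apply: down_and_across => //; right; split=> //; split; rewrite ?/a'; lra.
- have -> : - (k1 + k3) = n.+1%:R * l4 - (l1 + l3) by rewrite -natr1; lra.
  by apply: up_and_back => //; left; split=> //; split; rewrite ?/a'; lra.
Qed.

(** With [second_in_third], this is the source of the lineages: most of the new third tower runs
    inside the old second one, and most of the new second inside the old third. *)
Lemma third_in_second x (r : nat) : a' + k1 + k2 <= x < a' + k1 + k2 + k3 ->
  (r <= m)%N -> a + l1 <= iter (r * h2) T x < a + l1 + l2.
Proof.
have := ml1_ge; have := nl4_ge; case: lk => -[? ? ? ?] ? ? ? ? ? ?.
move=> /andP[x1 x2] rm.
have rl : r%:R * l1 <= m%:R * l1 by rewrite ler_wpM2r ?ler_nat //; lra.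
have r0 : 0 <= r%:R * l1 by rewrite mulr_ge0 //; lra.
have /(_ x) [] : tower a' b' (a' + k1 + k2) k3 (r * h2) (- (r%:R * l1)).
- by case: st => _ H _ _; apply: tower_left H; rewrite /b' /a'; lra.
- by rewrite x1.
by move=> -> _ _; move: x1 x2; rewrite /a' => x1 x2; apply/andP; split; lra.
Qed.

Lemma second_in_third x (r : nat) : a' + k1 <= x < a' + k1 + k2 ->
  (r < n)%N -> a + l1 + l2 <= iter (m * h2 + h1 + r * h3) T x < a + l1 + l2 + l3.
Proof.
have := ml1_ge; have := nl4_ge; case: lk => -[? ? ? ?] ? ? ? ? ? ?.
move=> /andP[x1 x2] rn.
have rl : r%:R * l4 <= n%:R * l4 - l4.
  by rewrite -[X in _ - X]mul1r -mulrBl ler_wpM2r //; [lra | rewrite lerBrDr natr1 ler_nat; lia].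
have r0 : 0 <= r%:R * l4 by rewrite mulr_ge0 //; lra.
have /(_ x) [] : tower a' b' (a' + k1) k2 (m * h2 + h1) (- (m%:R * l1) + (l2 + l4)).
- by apply: down_and_across => //; left; split=> //; split; rewrite ?/a'; lra.
- by rewrite x1.
move=> E _ _; rewrite addnC iterD E.
have /(_ (x + (- (m%:R * l1) + (l2 + l4)))) [] :
    tower a' b' (a' + l1 + k1 + k4) k2 (r * h3) (r%:R * l4).
- by case: st => _ _ H _; apply: tower_right H; rewrite /b' /a'; lra.
- by apply/andP; split; lra.
by move=> -> _ _; move: x1 x2; rewrite /a' => x1 x2; apply/andP; split; lra.
Qed.

End Step.
End Towers.

(** * Borel-Cantelli and measures of lower limits of sets *)

Section MeasureFacts.
Context {d : measure_display} {X : measurableType d} {R : realType}.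
Variable mu : {measure set X -> \bar R}.
Local Open Scope ereal_scope.

Lemma measure_bigsetU_le (s : seq nat) (F : nat -> set X) (r : R) :
  (forall i, measurable (F i)) -> (forall i, i \in s -> mu (F i) <= r%:E) ->
  mu (\big[setU/set0]_(i <- s) F i) <= ((size s)%:R * r)%:E.
Proof.
move=> mF; elim: s => [|i s IH] Fr; first by rewrite big_nil measure0 /= mul0r.
rewrite big_cons /= mulrSr mulrDl mul1r EFinD addeC.
apply: le_trans (measureU2 _ _ _) _ => //; first exact: bigsetU_measurable.
apply: leeD; first by apply: Fr; rewrite mem_head.
by apply: IH => j js; apply: Fr; rewrite in_cons js orbT.
Qed.

(** Borel-Cantelli; the bounds sum to [C]. *)
Lemma summable_ae_eventually_notin (F : nat -> set X) (C : R) :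
  (forall k, measurable (F k)) -> (forall k, mu (F k) <= (C / (2 ^ k.+1)%:R)%:E) ->
  {ae mu, forall x, exists K, forall k, (K <= k)%N -> ~ F k x}.
Proof.
move=> mF FC.
have C0 : (0 <= C)%R.
  have := le_trans (measure_ge0 mu _) (FC 0%N).
  by rewrite lee_fin pmulr_lge0 // invr_gt0 ltr0n expn_gt0.
have mu0 : mu (lim_sup_set F) = 0.
  apply: lim_sup_set_cvg0 => //.
  apply: (@le_lt_trans _ _ C%:E); last exact: ltry.
  apply: le_trans (epsilon_trick0 xpredT C0).
  by apply: lee_nneseries => // i _ _; exact: measure_ge0.
exists (lim_sup_set F); split => //.
  apply: bigcap_measurable; first by exists 0%N.
  by move=> n _; exact: bigcup_measurable.
move=> x /= H n _; apply: contrapT => H'; apply: H; exists n => k nk Fk.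
by apply: H'; exists k.
Qed.

(** The tail intersections increase with [K], and each lies in some [F k] of measure at most
    [r + e]. *)
Lemma measure_liminf_le (F : nat -> set X) (r : R) :
  (forall k, measurable (F k)) ->
  (forall K (e : R), (0 < e)%R -> exists2 k, (K <= k)%N & mu (F k) <= (r + e)%:E) ->
  mu (\bigcup_K \bigcap_(k in [set k | (K <= k)%N]) F k) <= r%:E.
Proof.
move=> mF Fr; set G := fun K => _.
have mG K : measurable (G K).
  by apply: bigcap_measurableType => k _.
have Gr K : mu (G K) <= r%:E.
  apply/lee_addgt0Pr => e e0; have [k Kk mk] := Fr K e e0.
  apply: le_trans mk; apply: le_measure; rewrite ?inE //.
  by move=> x Gx; exact: Gx.
have ndG : {homo G : n m / (n <= m)%N >-> (n <= m)%O}.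
  move=> m n mn; apply/subsetPset => x Gx k /= nk; apply: Gx => /=.
  exact: leq_trans nk.
have cG : (mu \o G) @ \oo --> mu (\bigcup_n G n).
  by apply: nondecreasing_cvg_mu => //; exact: bigcupT_measurable.
rewrite -(cvg_lim _ cG) //; apply: lime_le; first by apply/cvg_ex; eexists; exact: cG.
by apply: nearW => K; exact: Gr.
Qed.

End MeasureFacts.

(** * Criteria for a lower limit to be infinite or zero *)

Section LimInf.
Context {R : realType}.
Implicit Types u : nat -> R.

Lemma limn_einf_eqy u :
  (forall M : R, exists N, forall n, (N <= n)%N -> M <= u n) ->
  limn_einf (fun n => (u n)%:E) = +oo%E.
Proof.
move=> H; apply: (cvg_limn_einf_sup _).1; apply/cvgeyPge => M.
by have [N HN] := H M; exists N => // n /= Nn; rewrite lee_fin HN.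
Qed.

Lemma limn_einf_eq0 u : (forall n, 0 <= u n) ->
  (forall (e : R) N, 0 < e -> exists2 n, (N <= n)%N & u n <= e) ->
  limn_einf (fun n => (u n)%:E) = 0%E.
Proof.
move=> u0 H; rewrite limn_einf_lim; apply/cvg_lim => //.
rewrite (_ : einfs _ = cst 0%E); first exact: cvg_cst.
apply/funext => N /=; apply/eqP; rewrite eq_le; apply/andP; split.
  apply/lee_addgt0Pr => e e0; rewrite add0e; have [n Nn une] := H e N e0.
  apply: (@le_trans _ _ (u n)%:E); last by rewrite lee_fin.
  by apply: ereal_inf_lbound; exists n.
by apply: le_ereal_inf_tmp => _ [n _ <-]; rewrite lee_fin.
Qed.

End LimInf.

(** * Two lineages of towers *)

(** The cube of 2^(k+1): it absorbs the factor 2^k of [radius] and still leaves a summable bound. *)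
Definition growth (k : nat) : nat := 8 ^ k.+1.

(* At stage [k], lineage [s] is the tower of height [H s k] over the interval
   [c s k, c s k + w s k), whose return map is the translation by [dl s k].
   [Q s k] turns around the tower are safe for most points; [g s k i] selects the
   levels of stage [k.+1] lying in the stage [k] tower of the same lineage, and
   [ex s k] bounds the number of the other ones. *)
Record lineages {R : realType} (T : R -> R) (c w dl : bool -> nat -> R)
    (H Q ex : bool -> nat -> nat) (g : bool -> nat -> nat -> bool) : Prop := {
  lin_T01 : forall x, 0 <= x < 1 -> 0 <= T x < 1;
  lin_base01 : forall s k x, c s k <= x < c s k + w s k -> 0 <= x < 1;
  lin_w_gt0 : forall s k, 0 < w s k;
  lin_H_gt0 : forall s k, (0 < H s k)%N;
  lin_Q_gt0 : forall s k, (0 < Q s k)%N;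
  lin_iso : forall s k x i, c s k <= x < c s k + w s k -> (i < H s k)%N ->
    iter i T x = x + (iter i T (c s k) - c s k);
  lin_drift : forall s k x, c s k <= x < c s k + w s k ->
    iter (H s k) T x = x + dl s k;
  lin_dl_neq0 : forall s k, dl s k != 0;
  lin_disj : forall k s s' x x' i i', c s k <= x < c s k + w s k ->
    c s' k <= x' < c s' k + w s' k -> (i < H s k)%N -> (i' < H s' k)%N ->
    iter i T x = iter i' T x' -> s = s' /\ i = i';
  lin_dl_small : forall s k, `|dl s k| * (growth k * Q s k)%:R <= w s k;
  lin_Hw : forall s k, 1 / 2 - 1 / (2 ^ k.+2)%:R <= (H s k)%:R * w s k;
  lin_good : forall s k x i, c s k.+1 <= x < c s k.+1 + w s k.+1 ->
    (i < H s k.+1)%N -> g s k i -> exists j y,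
    [/\ (j < H s k)%N, c s k <= y < c s k + w s k & iter i T x = iter j T y];
  lin_ex : forall s k, (count (fun i => ~~ g s k i) (iota 0 (H s k.+1)) <= ex s k)%N;
  lin_ex_small : forall s k,
    (growth k * (H (~~ s) k + ex s k) <= Q s k * H s k)%N;
  lin_H_grow : forall s k, (growth k * (Q s k * H s k) <= H s k.+1)%N;
  lin_visits : forall x s k, 0 <= x < 1 -> exists t, c s k <= iter t T x < c s k + w s k
}.

Section Lineages.
Context {R : realType} (T : R -> R) (c w dl : bool -> nat -> R)
    (H Q ex : bool -> nat -> nat) (g : bool -> nat -> nat -> bool).
Hypothesis L : lineages T c w dl H Q ex g.
Local Notation mu := (@lebesgue_measure R).

Let base s k x := c s k <= x < c s k + w s k.

Definition level s k i : set R := `[iter i T (c s k), iter i T (c s k) + w s k[.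
Definition tow s k : set R := \big[setU/set0]_(i <- iota 0 (H s k)) level s k i.
Definition residual s k : set R :=
  \big[setU/set0]_(i <- [seq i <- iota 0 (H s k.+1) | ~~ g s k i]) level s k.+1 i.
(* Contains every point of the tower which [P] steps of length [dl] at the base
   would push out of it. *)
Definition exits s k (P : R) : set R :=
  \big[setU/set0]_(i <- iota 0 (H s k))
    `[iter i T (c s k) + (if 0 <= dl s k then w s k - P * dl s k else 0),
      iter i T (c s k) + (if 0 <= dl s k then w s k - P * dl s k else 0)
        + P * `|dl s k|[%classic.
Definition stay_time s k : nat := Q s k * H s k.
(** A distance of at least [radius s k] at a time of at least [stay_time s k] gives a product of at
    least 2^k. *)
Definition radius s k : R := (2 ^ k)%:R / (stay_time s k)%:R.
Definition ends s k i (r : R) : set R :=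
  `[iter i T (c s k) - r, iter i T (c s k) + r]%classic `|`
  `[iter i T (c s k) + w s k - r, iter i T (c s k) + w s k + r]%classic.
(** Where a point of lineage [~~ s] must lie if an orbit staying in the stage [k.+1] tower of [s]
    comes within [radius s k] of it: near an end of its own stage [k] level, or of a level rejected
    by [g]. *)
Definition collar s k : set R :=
  \big[setU/set0]_(i <- iota 0 (H (~~ s) k)) ends (~~ s) k i (radius s k) `|`
  \big[setU/set0]_(i <- [seq i <- iota 0 (H s k.+1) | ~~ g s k i])
    ends s k.+1 i (radius s k).
Definition uncovered k : set R := `[0, 1[%classic `\` (tow false k `|` tow true k).

Definition component s : set R := \bigcup_K \bigcap_(k in [set k | (K <= k)%N]) tow s k.

Definition typical_from K x := forall k s, (K <= k)%N ->
  [/\ ~ uncovered k x, ~ residual s k x, ~ exits s k (Q s k)%:R x & ~ collar s k x].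

Lemma levelP s k i z : (i < H s k)%N ->
  level s k i z <-> exists2 x, base s k x & z = iter i T x.
Proof.
move=> iH; rewrite /level /= in_itv /=; split.
  move=> zI; exists (z - (iter i T (c s k) - c s k)).
    by rewrite /base; case/andP: zI => *; apply/andP; split; lra.
  rewrite (lin_iso L _ iH) ?subrK //.
  by case/andP: zI => *; apply/andP; split; lra.
move=> [x xb ->]; rewrite (lin_iso L xb iH); case/andP: xb => *.
by apply/andP; split; lra.
Qed.

Lemma in_bigsetU (s : seq nat) (F : nat -> set R) z :
  (\big[setU/set0]_(i <- s) F i) z <-> exists2 i, i \in s & F i z.
Proof. by rewrite -bigcup_seq; split => -[i /= ? ?]; exists i. Qed.

Lemma towP s k z :
  tow s k z <-> exists i x, [/\ (i < H s k)%N, base s k x & z = iter i T x].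
Proof.
rewrite /tow in_bigsetU; split.
  by move=> [i]; rewrite mem_iota /= add0n => iH /(levelP _ iH) [x xb ->]; exists i, x.
move=> [i [x [iH xb ->]]]; exists i; first by rewrite mem_iota.
by apply/levelP => //; exists x.
Qed.

Lemma level_tow s k i z : (i < H s k)%N -> level s k i z -> tow s k z.
Proof. by move=> iH /(levelP _ iH) [x xb ->]; apply/towP; exists i, x. Qed.

Lemma level_disj s s' k i i' z : (i < H s k)%N -> (i' < H s' k)%N ->
  level s k i z -> level s' k i' z -> s = s' /\ i = i'.
Proof.
move=> iH iH' /(levelP _ iH) [x xb ->] /(levelP _ iH') [x' xb' E].
exact: (lin_disj L xb xb').
Qed.

Lemma tow_disj s s' k z : tow s k z -> tow s' k z -> s = s'.
Proof.
move=> /towP [i [x [iH xb ->]]] /towP [i' [x' [iH' xb' E]]].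
by have [] := lin_disj L xb xb' iH iH' E.
Qed.

Lemma measurable_level s k i : measurable (level s k i).
Proof. exact: measurable_itv. Qed.
Lemma measurable_tow s k : measurable (tow s k).
Proof. by apply: bigsetU_measurable => i _; exact: measurable_level. Qed.
Lemma measurable_residual s k : measurable (residual s k).
Proof. by apply: bigsetU_measurable => i _; exact: measurable_level. Qed.
Lemma measurable_exits s k P : measurable (exits s k P).
Proof. by apply: bigsetU_measurable => i _; exact: measurable_itv. Qed.
Lemma measurable_ends s k i r : measurable (ends s k i r).
Proof. by apply: measurableU; exact: measurable_itv. Qed.
Lemma measurable_collar s k : measurable (collar s k).
Proof. by apply: measurableU; apply: bigsetU_measurable => i _; exact: measurable_ends. Qed.
Lemma measurable_uncovered k : measurable (uncovered k).
Proof. by apply: measurableD => //; apply: measurableU; exact: measurable_tow. Qed.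
Lemma measurable_comp s : measurable (component s).
Proof.
by apply: bigcupT_measurable => K; apply: bigcap_measurableType => k _;
  exact: measurable_tow.
Qed.

(** * Measures of the towers and of the exceptional sets *)

Lemma mu_itv_co (a r : R) : 0 <= r -> mu `[a, a + r[%classic = r%:E.
Proof.
move=> r0; rewrite lebesgue_measure_itv /= lte_fin -EFinB [a + r]addrC addrK.
by case: ltP => // ?; congr (_%:E); lra.
Qed.

Lemma mu_itv_cc (a r : R) : 0 <= r -> mu `[a - r, a + r]%classic = (2 * r)%:E.
Proof.
move=> r0; rewrite lebesgue_measure_itv /= lte_fin -EFinB.
by case: ltP => ?; congr (_%:E); lra.
Qed.

Lemma mu_tow s k : mu (tow s k) = ((H s k)%:R * w s k)%:E.
Proof.
rewrite /tow -[X in iota 0 X]subn0 -/(index_iota 0 (H s k)) big_mkord.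
have w0 := lin_w_gt0 L s k.
rewrite (measure_semi_additive_ord mu (F := fun i : 'I_(H s k) => level s k i)).
- rewrite (eq_bigr (fun=> (w s k)%:E)); last by move=> i _; exact: mu_itv_co (ltW w0).
  by rewrite sumEFin sumr_const card_ord mulr_natl.
- by move=> i; exact: measurable_level.
- move=> i j _ _ [z [zi zj]]; apply: val_inj.
  by have [] := level_disj (ltn_ord i) (ltn_ord j) zi zj.
- by apply: bigsetU_measurable => i _; exact: measurable_level.
Qed.

Lemma iter01 x n : 0 <= x < 1 -> 0 <= iter n T x < 1.
Proof. by move=> x01; elim: n => //= n; exact: lin_T01 L _. Qed.

Lemma tow01 s k : tow s k `<=` `[0, 1[%classic.
Proof.
move=> z /towP [i [x [_ xb ->]]] /=; rewrite in_itv /=; apply: iter01.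
exact: lin_base01 L _ _ _ xb.
Qed.

Lemma mu_tows k : mu (tow false k `|` tow true k) =
  ((H false k)%:R * w false k + (H true k)%:R * w true k)%:E.
Proof.
rewrite EFinD -!mu_tow; apply: measureU; [exact: measurable_tow|
  exact: measurable_tow|].
by apply/seteqP; split => // z [/tow_disj] /[apply].
Qed.

Lemma mu_01 : mu `[0, 1[%classic = 1%:E :> \bar R.
Proof. by rewrite -[X in `[_, X[%classic](@add0r R) mu_itv_co. Qed.

Lemma tows_le1 k : (H false k)%:R * w false k + (H true k)%:R * w true k <= 1.
Proof.
rewrite -lee_fin -mu_tows -mu_01; apply: le_measure; rewrite ?inE //.
  by apply: measurableU; exact: measurable_tow.
by move=> z []; exact: tow01.
Qed.

(** The other tower is disjoint from this one and already fills almost half of [0, 1). *)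
Lemma tow_le s k : (H s k)%:R * w s k <= 1 / 2 + 1 / (2 ^ k.+2)%:R.
Proof.
by have := tows_le1 k; have := lin_Hw L false k; have := lin_Hw L true k;
  case: s => *; lra.
Qed.

Lemma tow_le1 s k : (H s k)%:R * w s k <= 1.
Proof.
have := tows_le1 k; have := lin_w_gt0 L false k; have := lin_w_gt0 L true k.
have h (a : R) : 0 < a -> forall n : nat, 0 <= n%:R * a.
  by move=> ? n; rewrite mulr_ge0 // ltW.
by move=> /h /(_ (H true k)) ? /h /(_ (H false k)) ?; case: s => *; lra.
Qed.

Lemma growth_ge k : (2 ^ k.+1 * 2 ^ k.+1 * 2 ^ k.+1 <= growth k)%N.
Proof. by rewrite /growth -!expnMn. Qed.

Lemma growthR k : (growth k)%:R = (2 ^ k.+1)%:R ^+ 3 :> R.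
Proof. by rewrite /growth -natrX -expnM mulnC expnM. Qed.

Lemma pow2_ge1 k : 1 <= (2 ^ k)%:R :> R.
Proof. by rewrite ler1n expn_gt0. Qed.

Lemma growth_inv_le k (x : R) : 0 <= x -> x * (growth k)%:R <= 1 ->
  x <= 1 / (2 ^ k.+1)%:R.
Proof.
move=> x0; rewrite growthR; have := pow2_ge1 k.+1.
set p := (2 ^ _)%:R => p1 xp; rewrite ler_pdivlMr; last lra.
apply: le_trans xp; rewrite ler_wpM2l // exprS.
by rewrite ler_peMr ?exprn_ege1 //; lra.
Qed.

Lemma mu_uncovered k : (mu (uncovered k) <= (1 / (2 ^ k.+1)%:R)%:E)%E.
Proof.
have mT : measurable (tow false k `|` tow true k).
  by apply: measurableU; exact: measurable_tow.
rewrite /uncovered measureD //=; last by rewrite -/mu mu_01 ltry.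
rewrite -/mu mu_01 setIidr; last by move=> z []; exact: tow01.
rewrite mu_tows -EFinB lee_fin.
have := lin_Hw L false k; have := lin_Hw L true k.
have -> : 1 / (2 ^ k.+1)%:R = 2 * (1 / (2 ^ k.+2)%:R) :> R.
  rewrite [in RHS]expnS natrM; have := pow2_ge1 k.+1; set p := (_)%:R => ?.
  by field; lra.
by move=> *; lra.
Qed.

Lemma size_residual s k :
  (size [seq i <- iota 0 (H s k.+1) | ~~ g s k i] <= ex s k)%N.
Proof. by rewrite size_filter; exact: lin_ex L s k. Qed.

Lemma mu_residual s k : (mu (residual s k) <= (1 / (2 ^ k.+1)%:R)%:E)%E.
Proof.
have w0 := lin_w_gt0 L s k.+1.
apply: (le_trans (measure_bigsetU_le (r := w s k.+1) _ _)).
- by move=> i; exact: measurable_level.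
- by move=> i _; rewrite [X in (X <= _)%E](mu_itv_co _ (ltW w0)).
rewrite lee_fin.
apply: (@le_trans _ _ ((ex s k)%:R * w s k.+1)).
  by rewrite ler_wpM2r ?ler_nat ?size_residual // ltW.
apply: growth_inv_le; first by rewrite mulr_ge0 // ltW.
apply: le_trans (tow_le1 s k.+1).
rewrite mulrAC ler_wpM2r ?(ltW w0) // -natrM ler_nat.
have := lin_ex_small L s k; have := lin_H_grow L s k.
have g1 : (0 < growth k)%N by rewrite expn_gt0.
have := leq_pmull (Q s k * H s k) g1; lia.
Qed.

Lemma mu_exits s k P : 0 <= P ->
  (mu (exits s k P) <= ((H s k)%:R * (P * `|dl s k|))%:E)%E.
Proof.
move=> P0.
apply: (le_trans (measure_bigsetU_le (r := P * `|dl s k|) _ _)).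
- by move=> i; exact: measurable_itv.
- by move=> i _; rewrite [X in (X <= _)%E]mu_itv_co // mulr_ge0.
by rewrite size_iota.
Qed.

Lemma mu_exits_Q s k : (mu (exits s k (Q s k)%:R) <= (1 / (2 ^ k.+1)%:R)%:E)%E.
Proof.
apply: le_trans (mu_exits _ _ _) _ => //; rewrite lee_fin.
apply: growth_inv_le; first by rewrite !mulr_ge0.
apply: le_trans (tow_le1 s k); rewrite -mulrA ler_wpM2l //.
by have := lin_dl_small L s k; rewrite natrM; lra.
Qed.

Lemma stay_time_gt0 s k : 0 < (stay_time s k)%:R :> R.
Proof. by rewrite ltr0n muln_gt0 (lin_Q_gt0 L) (lin_H_gt0 L). Qed.

Lemma radius_ge0 s k : 0 <= radius s k.
Proof. by rewrite divr_ge0. Qed.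

Lemma mu_ends s k i r : 0 <= r -> (mu (ends s k i r) <= (4 * r)%:E)%E.
Proof.
move=> r0; apply: (le_trans (measureU2 mu (measurable_itv _) (measurable_itv _))).
rewrite [X in (X + _ <= _)%E]mu_itv_cc // [X in (_ + X <= _)%E]mu_itv_cc //.
by rewrite -EFinD lee_fin; lra.
Qed.

(** At most [H (~~ s) k + ex s k] levels are involved, which by [lin_ex_small] is [growth k] times
    smaller than the stay time; this beats the 2^k of the radius. *)
Lemma mu_collar s k : (mu (collar s k) <= (4 / (2 ^ k.+1)%:R)%:E)%E.
Proof.
have r0 := radius_ge0 s k.
have mE s' k' i : measurable (ends s' k' i (radius s k)).
  exact: measurable_ends.
rewrite /collar; set A := (X in X `|` _); set B := (X in _ `|` X).
have mA : measurable A by exact: bigsetU_measurable.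
have mB : measurable B by exact: bigsetU_measurable.
apply: (le_trans (measureU2 mu mA mB)); rewrite {mA mB}/A {}/B.
apply: (le_trans (leeD (measure_bigsetU_le (r := 4 * radius s k) _ _)
                       (measure_bigsetU_le (r := 4 * radius s k) _ _))).
- by move=> i; exact: mE.
- by move=> i _; exact: mu_ends.
- by move=> i; exact: mE.
- by move=> i _; exact: mu_ends.
rewrite -EFinD lee_fin -mulrDl size_iota -natrD.
apply: (@le_trans _ _ ((H (~~ s) k + ex s k)%:R * (4 * radius s k))).
  by rewrite ler_wpM2r ?mulr_ge0 // ler_nat leq_add2l size_residual.
have p0 : 0 < (2 ^ k.+1)%:R :> R by rewrite ltr0n expn_gt0.
have -> (n : R) : n * (4 * radius s k) = 4 * (n * (2 ^ k)%:R / (stay_time s k)%:R).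
  by rewrite /radius; ring.
rewrite ler_wpM2l // ler_pdivrMr ?stay_time_gt0 // [_^-1 * _]mulrC ler_pdivlMr //.
rewrite -!natrM ler_nat; apply: leq_trans (lin_ex_small L s k).
rewrite -mulnA mulnC leq_mul2r; apply/orP; right.
apply: leq_trans (growth_ge k); rewrite leq_mul2r; apply/orP; right.
by rewrite -expnD leq_exp2l //; lia.
Qed.

Lemma ae_typical : {ae mu, forall x, exists K, typical_from K x}.
Proof.
have U := summable_ae_eventually_notin (mu := mu) measurable_uncovered mu_uncovered.
have B1 s := summable_ae_eventually_notin (mu := mu) (measurable_residual s) (mu_residual s).
have B2 s := summable_ae_eventually_notin (mu := mu)
  (fun k => measurable_exits s k _) (mu_exits_Q s).
have B3 s := summable_ae_eventually_notin (mu := mu) (measurable_collar s) (mu_collar s).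
have B s : {ae mu, forall x, exists K, forall k, (K <= k)%N ->
    [/\ ~ residual s k x, ~ exits s k (Q s k)%:R x & ~ collar s k x]}.
  move: (B1 s) (B2 s) (B3 s); apply: filterS3 => x [K1 h1] [K2 h2] [K3 h3].
  exists (maxn K1 (maxn K2 K3)) => k; rewrite !geq_max => /and3P[? ? ?].
  by split; [exact: h1|exact: h2|exact: h3].
move: U (B false) (B true); apply: filterS3 => x [K1 h1] [K2 h2] [K3 h3].
exists (maxn K1 (maxn K2 K3)) => k s; rewrite !geq_max => /and3P[? ? ?].
have ? := h1 k ltac:(assumption).
case: s; first by have [] := h3 k ltac:(assumption).
by have [] := h2 k ltac:(assumption).
Qed.

(** A point changing lineage between two stages would be in a level selected by [g], hence in both
    stage [k] towers, or else in [residual]. *)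
Lemma tow_lineage s K x : typical_from K x -> tow s K x ->
  forall k, (K <= k)%N -> tow s k x.
Proof.
move=> tK xK; elim=> [|k IH]; first by rewrite leqn0 => /eqP <-.
rewrite leq_eqVlt => /predU1P[<- //|Kk]; have {IH} xk := IH Kk.
have x01 := tow01 xk.
have [//|xk'] : tow s k.+1 x \/ tow (~~ s) k.+1 x.
  have [/= nu _ _ _] := tK k.+1 s (leqW Kk); apply: contrapT => no; apply: nu.
  split => //; apply: contra_not no.
  by case: (s) => -[] ?; [right|left|left|right].
have [_ nr _ _] := tK k (~~ s) Kk.
move: xk' => /[dup] xk' /towP [i [y [iH yb xE]]].
have [gi|gi] := boolP (g (~~ s) k i).
  have [j [z [jH zb E]]] := lin_good L yb iH gi.
  have : tow (~~ s) k x by apply/towP; exists j, z; split => //; rewrite xE.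
  by move=> /(tow_disj xk); case: (s).
exfalso; apply: nr; apply/in_bigsetU; exists i.
  by rewrite mem_filter gi mem_iota.
by apply/levelP => //; exists y.
Qed.

Lemma typical_comp K x : 0 <= x < 1 -> typical_from K x -> exists s,
  forall k, (K <= k)%N -> tow s k x.
Proof.
move=> x01 tK; have [/= nu _ _ _] := tK K true (leqnn K).
have [s xs] : exists s, tow s K x.
  apply: contrapT => no; apply: nu; split; first by rewrite /= in_itv.
  by move=> -[h|h]; apply: no; eexists; exact: h.
by exists s; exact: tow_lineage.
Qed.

Lemma comp_eventually s x : component s x <-> exists K, forall k, (K <= k)%N -> tow s k x.
Proof. by split=> [[K _ h]|[K h]]; exists K. Qed.

Lemma comp_disj s s' x : component s x -> component s' x -> s = s'.
Proof.
move=> /comp_eventually [K h] /comp_eventually [K' h'].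
by apply: (@tow_disj _ _ (maxn K K') x); [apply: h|apply: h']; lia.
Qed.

Lemma base_convex s k b (P r : R) : 0 <= r <= P -> base s k b ->
  base s k (b + P * dl s k) -> base s k (b + r * dl s k).
Proof.
rewrite /base => /andP[r0 rP] /andP[b1 b2] /andP[c1 c2].
have [d0|d0] := leP 0 (dl s k).
  have ? : 0 <= r * dl s k by rewrite mulr_ge0.
  have ? : r * dl s k <= P * dl s k by rewrite ler_wpM2r.
  by apply/andP; split; lra.
have ? : r * dl s k <= 0 by rewrite mulr_ge0_le0 // ltW.
have ? : P * dl s k <= r * dl s k by rewrite ler_wnM2r // ltW.
by apply/andP; split; lra.
Qed.

Lemma drift_iter s k b (n : nat) : base s k b -> base s k (b + n%:R * dl s k) ->
  iter (n * H s k) T b = b + n%:R * dl s k.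
Proof.
move=> b0; elim: n => [|n IH] bn; first by rewrite mul0n mul0r addr0.
have bn' : base s k (b + n%:R * dl s k).
  by apply: base_convex bn => //; rewrite ler0n ler_nat /=.
by rewrite mulSn iterD IH // (lin_drift L bn') -addrA -natr1 mulrDl mul1r.
Qed.

Lemma not_exits s k P x : 0 <= P -> tow s k x -> ~ exits s k P x ->
  exists i b, [/\ (i < H s k)%N, base s k b, base s k (b + P * dl s k) &
                  x = iter i T b].
Proof.
move=> P0 /towP [i [b [iH bb xE]]] nx; exists i, b; split => //.
apply: contrapT => nb; apply: nx; apply/in_bigsetU; exists i.
  by rewrite mem_iota.
rewrite /= in_itv /= xE (lin_iso L bb iH).
move: bb nb; rewrite /base => /andP[b1 b2] /negP; rewrite negb_and -!ltNge -leNgt.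
have [d0|d0] := leP 0 (dl s k).
  have ? : 0 <= P * dl s k by rewrite mulr_ge0.
  by rewrite ger0_norm // => /orP[?|?]; apply/andP; split; lra.
have ? : P * dl s k <= 0 by rewrite mulr_ge0_le0 // ltW.
by rewrite ltr0_norm // => /orP[?|?]; apply/andP; split; lra.
Qed.

Lemma stay_tow s k x n : tow s k x -> ~ exits s k (Q s k)%:R x ->
  (n <= stay_time s k)%N -> tow s k (iter n T x).
Proof.
move=> xt /(not_exits _ xt) -/(_ (ler0n _ _)) [i [b [iH b0 bQ ->]]] nQ.
rewrite -iterD (divn_eq (n + i) (H s k)) addnC iterD.
(* As [i] is less than one turn, [n + i] is less than [Q + 1] turns. *)
have rQ : ((n + i) %/ H s k <= Q s k)%N.
  by rewrite -ltnS ltn_divLR ?(lin_H_gt0 L) // mulSn; move: nQ; rewrite /stay_time; lia.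
have br : base s k (b + ((n + i) %/ H s k)%:R * dl s k).
  by apply: base_convex bQ => //; rewrite ler0n ler_nat.
rewrite drift_iter //; apply/towP.
by do 2!eexists; split; [|exact: br|reflexivity]; rewrite ltn_mod (lin_H_gt0 L).
Qed.

(** * Points in different lineages *)

Lemma ends_out s k i r y z : level s k i z -> ~ level s k i y ->
  `|z - y| <= r -> ends s k i r y.
Proof.
rewrite /level /ends /= !in_itv /= => /andP[z1 z2] /negP.
rewrite negb_and -ltNge -leNgt ler_norml => /orP[?|?] /andP[? ?].
  by left; apply/andP; split; lra.
by right; apply/andP; split; lra.
Qed.

Lemma ends_in s k i r y z : level s k i y -> ~ level s k i z ->
  `|z - y| <= r -> ends s k i r y.
Proof.
rewrite /level /ends /= !in_itv /= => /andP[z1 z2] /negP.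
rewrite negb_and -ltNge -leNgt ler_norml => /orP[?|?] /andP[? ?].
  by left; apply/andP; split; lra.
by right; apply/andP; split; lra.
Qed.

(** Up to the stay time, [iter n T x] is in a level of the stage [k.+1] tower of [s]. If [g] selects
    it, the point is also in the stage [k] tower of [s], hence outside the level of [y]; otherwise
    [y] is outside that level. Either way closeness puts [y] near an end of a level counted in
    [collar]. *)
Lemma orbit_away s K x y k n : typical_from K x -> typical_from K y ->
  (forall k, (K <= k)%N -> tow s k x) -> (forall k, (K <= k)%N -> tow (~~ s) k y) ->
  (K <= k)%N -> (n <= stay_time s k.+1)%N -> radius s k < `|iter n T x - y|.
Proof.
move=> tx ty xs ys Kk nst; rewrite ltNge; apply/negP => close.
have [_ _ nex _] := tx k.+1 s (leqW Kk).
have := stay_tow (xs _ (leqW Kk)) nex nst.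
have [_ _ _ ncol] := ty k s Kk; move=> /towP [j [b [jH bb zE]]].
have zlev : level s k.+1 j (iter n T x) by apply/levelP => //; exists b.
apply: ncol; have [gj|gj] := boolP (g s k j); last first.
  right; apply/in_bigsetU; exists j; first by rewrite mem_filter gj mem_iota.
  apply: ends_out zlev _ close => /(level_tow jH) yt.
  by have := tow_disj yt (ys _ (leqW Kk)); case: (s).
have [j' [b' [jH' bb' E]]] := lin_good L bb jH gj.
have zt : tow s k (iter n T x) by apply/towP; exists j', b'; rewrite zE E.
left; have /in_bigsetU [i iI yl] := ys _ Kk; apply/in_bigsetU; exists i => //.
apply: ends_in yl _ close => zl; move: iI; rewrite mem_iota /= add0n => iH.
by have := tow_disj zt (level_tow iH zl); case: (s).
Qed.

Lemma growth_le_stay s k : (growth k <= stay_time s k)%N.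
Proof.
apply: leq_trans (lin_ex_small L s k).
by rewrite leq_pmulr // addn_gt0 (lin_H_gt0 L).
Qed.

Lemma ltn_growth k : (k < growth k)%N.
Proof. by apply: (@ltn_trans k.+1) => //; exact: ltn_expl. Qed.

Lemma phi1_cross s x y : (exists K, typical_from K x) -> (exists K, typical_from K y) ->
  component s x -> component (~~ s) y -> phi1 T x y = +oo%E.
Proof.
move=> [K1 tx] [K2 ty] /comp_eventually [K3 xs] /comp_eventually [K4 ys].
apply: limn_einf_eqy => M.
set K := maxn (maxn K1 K2) (maxn K3 K4).
pose K0 := maxn K (Num.truncn M).+1; exists (stay_time s K0) => n nK0.
(* Stay times are unbounded, so descending from stage [K0 + n] meets consecutive stay times that
   enclose [n]. *)
have [k Kk /andP[n1 n2]] : exists2 k, (K0 <= k)%N &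
    (stay_time s k <= n <= stay_time s k.+1)%N.
  have : (n <= stay_time s (K0 + n).+1)%N.
    apply: leq_trans (growth_le_stay s _); apply: leq_trans (ltnW (ltn_growth _)).
    by rewrite -addnS; lia.
  elim: {2}n => [|m IH] nm; first by exists K0; rewrite // nK0 -[K0]addn0.
  have [h|h] := leqP n (stay_time s (K0 + m).+1); first exact: IH.
  by exists (K0 + m).+1; [lia|rewrite (ltnW h) /= -addnS].
apply: (@le_trans _ _ (2 ^ k)%:R).
  have [M0|M0] := leP 0 M; last by apply: ltW; apply: lt_le_trans M0 _.
  apply: (@le_trans _ _ (Num.truncn M).+1%:R); first exact/ltW/truncnS_gt.
  rewrite ler_nat; apply: leq_trans (ltnW (ltn_expl _ (ltnSn 1))); lia.
have r : radius s k <= `|iter n T x - y|.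
  apply/ltW/(@orbit_away s K) => //; last by lia.
  - by move=> k' s' h; apply: tx; lia.
  - by move=> k' s' h; apply: ty; lia.
  - by move=> k' h; apply: xs; lia.
  - by move=> k' h; apply: ys; lia.
have -> : (2 ^ k)%:R = (stay_time s k)%:R * radius s k.
  by rewrite /radius mulrCA divff ?mulr1 // gt_eqF // stay_time_gt0.
by apply: ler_pM => //; [exact: radius_ge0 | rewrite ler_nat].
Qed.

(** After [p], the integer part of [tau], turns, the orbit passes level [j] less than one step [dl]
    from the target, at a time below [(p + 1) * H]. The bound [2 <= tau] makes this time at least
    [H], hence arbitrarily late over the stages. *)
Lemma return_close s k i j b (P tau : R) :
  (i < H s k)%N -> (j < H s k)%N -> base s k b -> base s k (b + P * dl s k) ->
  2 <= tau <= P -> exists2 n, (H s k <= n)%N &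
    n%:R * `|iter n T (iter i T b) - iter j T (b + tau * dl s k)|
      <= (P + 1) * ((H s k)%:R * `|dl s k|).
Proof.
move=> iH jH b0 bP /andP[tau2 tauP].
have tau0 : 0 <= tau by lra.
have /andP[p1 p2] := truncn_itv tau0; set p := Num.truncn tau in p1 p2.
have p_ge2 : (2 <= p)%N by rewrite truncn_ge_nat.
have [p' pE] : exists p', p = p'.+1 by exists p.-1; lia.
have bp : base s k (b + p%:R * dl s k) by apply: base_convex bP => //; rewrite ler0n /=; lra.
have btau : base s k (b + tau * dl s k) by apply: base_convex bP => //; lra.
exists (j + p * H s k - i)%N.
  have : (H s k * 2 <= p * H s k)%N by rewrite mulnC leq_mul2r p_ge2 orbT.
  lia.
rewrite -iterD subnK; last first.
  by rewrite pE mulSn; lia.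
rewrite iterD drift_iter // (lin_iso L bp jH) (lin_iso L btau jH).
have -> : b + p%:R * dl s k + (iter j T (c s k) - c s k)
    - (b + tau * dl s k + (iter j T (c s k) - c s k)) = (p%:R - tau) * dl s k by ring.
rewrite normrM mulrA mulrA; apply: ler_wpM2r => //.
have : `|p%:R - tau| <= 1 by rewrite ler_norml; apply/andP; split; lra.
move=> /(ler_wpM2l (ler0n R (j + p * H s k - i)%N)).
rewrite mulr1 => /le_trans; apply.
apply: (@le_trans _ _ ((p + 1) * H s k)%:R).
  by rewrite ler_nat mulnDl mul1n; lia.
by rewrite natrM natrD; apply: ler_wpM2r => //; lra.
Qed.

(** This number of steps of length [|dl|] sweeps the proportion [e] of the base; infinitely many
    such stages suffice for a lower limit. *)
Definition has_room s (e : R) x := forall K, exists2 k, (K <= k)%N &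
  tow s k x /\ ~ exits s k (e * w s k / `|dl s k|) x.

Lemma ndl_gt0 s k : 0 < `|dl s k|.
Proof. by rewrite normr_gt0 (lin_dl_neq0 L). Qed.

Lemma mu_exits_part s k e : 0 <= e ->
  (mu (exits s k (e * w s k / `|dl s k|)) <= e%:E)%E.
Proof.
move=> e0; have w0 := lin_w_gt0 L s k; have d0 := ndl_gt0 s k.
apply: le_trans (mu_exits _ _ _) _; first by rewrite !mulr_ge0 ?invr_ge0 // ltW.
rewrite divfK ?gt_eqF // lee_fin mulrCA -[leRHS]mulr1.
by rewrite ler_wpM2l // tow_le1.
Qed.

(** The points of the component failing for [e] are eventually always in an [exits] set of measure
    at most [e]; failing for every [e] is therefore null. *)
Lemma ae_has_room s : {ae mu, forall x, component s x ->
  exists2 e : R, 0 < e & has_room s e x}.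
Proof.
pose F (e : R) k := tow s k `&` exits s k (e * w s k / `|dl s k|).
pose X e := \bigcup_K \bigcap_(k in [set k | (K <= k)%N]) F e k.
have mF e k : measurable (F e k).
  by apply: measurableI; [exact: measurable_tow|exact: measurable_exits].
have mX e : measurable (X e).
  by apply: bigcupT_measurable => K; apply: bigcap_measurableType => k _; exact: mF.
have Xe (e : R) : 0 < e -> (mu (X e) <= e%:E)%E.
  move=> e0; apply: measure_liminf_le; first exact: mF.
  move=> K r r0; exists K => //.
  apply: (@le_trans _ _ e%:E); last by rewrite lee_fin; lra.
  apply: le_trans (mu_exits_part s K (ltW e0)); apply: le_measure; rewrite ?inE.
  - exact: mF.
  - exact: measurable_exits.
  - by move=> z [].
exists (\bigcap_n X n.+1%:R^-1); split.
- by apply: bigcap_measurableType => n _; exact: mX.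
- apply/eqP; rewrite eq_le measure_ge0 andbT; apply/lee_addgt0Pr => e e0.
  rewrite add0e; pose n := Num.truncn e^-1.
  apply: (@le_trans _ _ (mu (X n.+1%:R^-1))).
    apply: le_measure; rewrite ?inE; [|exact: mX|].
      by apply: bigcap_measurableType => ? _; exact: mX.
    by move=> x; apply.
  apply: le_trans (Xe _ _) _; first by rewrite invr_gt0.
  rewrite lee_fin -[leRHS]invrK lef_pV2 ?posrE ?invr_gt0 //.
  exact/ltW/truncnS_gt.
- move=> x /= nx n _; apply: contrapT => nX; apply: nx => xs.
  exists n.+1%:R^-1; first by rewrite invr_gt0.
  have /comp_eventually [K0 xK0] := xs.
  move=> K; apply: contrapT => no; apply: nX; exists (maxn K K0) => //= k kK.
  have /andP[kK1 kK2] : (K <= k)%N && (K0 <= k)%N by rewrite -geq_max.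
  have xk : tow s k x by exact: xK0.
  split => //; apply: contrapT => nex; apply: no; exists k => //.
Qed.

Definition orbit_avoids (e : R) N x : set R :=
  [set y | forall n, (N <= n)%N -> e < n%:R * `|iter n T x - y|].

Lemma measurable_orbit_avoids e N x : measurable (orbit_avoids e N x).
Proof.
have -> : orbit_avoids e N x = \bigcap_(n in [set n | (N <= n)%N])
    [set y | e < n%:R * `|iter n T x - y|] by [].
apply: bigcap_measurableType => n _.
have mf : measurable_fun setT (fun y : R => n%:R * `|iter n T x - y|).
  apply: measurable_funM => //; apply: measurableT_comp => //.
  exact: measurable_funB.
have -> : [set y | e < n%:R * `|iter n T x - y|] =
    setT `&` (fun y : R => n%:R * `|iter n T x - y|) @^-1` `]e, +oo[.
  by rewrite setTI; apply/seteqP; split => y /=; rewrite in_itv /= andbT.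
by apply: mf => //; exact: measurable_itv.
Qed.

Lemma leq_H s k : (k <= H s k)%N.
Proof.
case: k => // k; apply: leq_trans (lin_H_grow L s k).
rewrite (leq_trans (ltn_growth k)) // leq_pmulr // muln_gt0.
by rewrite (lin_Q_gt0 L) (lin_H_gt0 L).
Qed.

Lemma w_small s (r : R) : 0 < r -> exists K, forall k, (K <= k)%N -> w s k < r.
Proof.
move=> r0; exists (Num.truncn r^-1).+1 => k Kk.
have rk : r^-1 < (H s k)%:R.
  apply: lt_le_trans (truncnS_gt _) _; rewrite ler_nat.
  exact: leq_trans Kk (leq_H s k).
have h0 : 0 < (H s k)%:R :> R by rewrite ltr0n (lin_H_gt0 L).
have : (H s k)%:R * w s k < (H s k)%:R * r.
  apply: le_lt_trans (tow_le1 s k) _.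
  have : r^-1 * r < (H s k)%:R * r by rewrite ltr_pM2r.
  by rewrite mulVf ?lt0r_neq0.
by rewrite ltr_pM2l.
Qed.

Lemma dl_le s k : `|dl s k| * (growth k)%:R <= w s k.
Proof.
apply: le_trans (lin_dl_small L s k); rewrite natrM mulrA ler_peMr //.
by rewrite ler1n (lin_Q_gt0 L).
Qed.

(* Lebesgue density in the single variable [y]: a fixed proportion [G] of the
   level containing [y] is approached closely by the orbit of [x], because that
   orbit sweeps the level with the tiny step [dl]. *)
Lemma ae_not_orbit_avoids s x (e : R) N : (exists2 e0 : R, 0 < e0 & has_room s e0 x) ->
  0 < e -> {ae mu, forall y, component s y -> ~ orbit_avoids e N x y}.
Proof.
move=> [e0 e0_gt0 room] e_gt0; set F := orbit_avoids e N x.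
have mF : measurable F := measurable_orbit_avoids e N x.
apply: (@filterS _ _ (ae_filter_ringOfSetsType mu) _ _ _ (lebesgue_density mF)) => /= y dens.
move=> /comp_eventually [K0 yK0] Fy; move: dens; rewrite indicE mem_set //= => dens.
(* [e0] bounds the available room; [e / 2] makes the final estimate [e1 + e1 / 4] at most [e]. *)
pose e1 := Num.min e0 (e / 2).
have e1_gt0 : 0 < e1 by rewrite lt_min e0_gt0 divr_gt0.
have e1e0 : e1 <= e0 by rewrite ge_min lexx.
have e1e : e1 <= e / 2 by rewrite ge_min lexx orbT.
(* The set [G] below has length at least [e1 * w / 2] in a ball of length [2 * w]: a proportion of
   at least [e1 / 4], contradicting this density. *)
have [r0 r0_gt0 Hr0] : exists2 r0 : R, 0 < r0 & forall r, 0 < r < r0 ->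
    ((1 - e1 / 4)%:E < mu (F `&` ball y r) * (mu (ball y r))^-1)%E.
  have /fine_cvgP[fin lim1] := dens.
  have gt1 : 1 - e1 / 4 < 1 by lra.
  have [r0 /= r0_gt0 h] := filterI fin (cvgr_gt 1 lim1 _ gt1).
  exists r0 => // r /andP[r_gt0 rr0].
  have [] := h r; rewrite //= ?sub0r ?normrN ?gtr0_norm // => rfin.
  by rewrite -{2}(fineK rfin) lte_fin.
have [K1 wK1] := w_small s r0_gt0.
pose K2 := Num.truncn (4 / e1).
have [k + [xk nx]] := room (maxn (maxn K0 K1) (maxn K2 N)).
rewrite !geq_max => /andP[/andP[kK0 kK1] /andP[kK2 kN]].
have w_gt0 := lin_w_gt0 L s k; have d_gt0 := ndl_gt0 s k.
have wr0 : 0 < w s k < r0 by rewrite w_gt0 wK1.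
have d_small : `|dl s k| <= e1 / 4 * w s k.
  have g4 : 4 / e1 <= (growth k)%:R.
    apply/ltW/(lt_le_trans (truncnS_gt _)); rewrite ler_nat.
    exact: leq_ltn_trans kK2 (ltn_growth k).
  have := le_trans (ler_wpM2l (normr_ge0 (dl s k)) g4) (dl_le s k).
  by rewrite mulrA ler_pdivrMr //; lra.
have P0 : 0 <= e0 * w s k / `|dl s k| by rewrite !mulr_ge0 ?invr_ge0 // ltW.
have [i [b [iH bb bP xE]]] := not_exits P0 xk nx.
pose P := e1 * w s k / `|dl s k|.
have PE : P * `|dl s k| = e1 * w s k by rewrite divfK // gt_eqF.
have P4 : 4 <= P by rewrite ler_pdivlMr //; lra.
have {}bP : base s k (b + P * dl s k).
  apply: base_convex bP => //; apply/andP; split; first lra.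
  by rewrite ler_pM2r ?invr_gt0 // ler_pM2r.
have /towP [j [t [jH tb yE]]] : tow s k y by exact: yK0.
pose o := iter j T (c s k) - c s k.
(* [G] consists of the points of the level of [y] reached for [tau] in [2, [P]]; the centred form
   treats both signs of [dl] at once. *)
pose m := b + (P + 2) / 2 * dl s k + o.
pose q := (P - 2) / 2 * `|dl s k|.
have q0 : 0 <= q by rewrite mulr_ge0 //; lra.
pose G := `[m - q, m + q]%classic.
have GP z : G z -> exists2 tau, 2 <= tau <= P & z = iter j T (b + tau * dl s k).
  rewrite /G /= in_itv /= => /andP[z1 z2].
  pose tau := (z - b - o) / dl s k.
  have tauE : tau * dl s k = z - b - o by rewrite divfK ?(lin_dl_neq0 L).
  have : `|tau - (P + 2) / 2| <= (P - 2) / 2.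
    rewrite -(ler_pM2r d_gt0) -normrM mulrBl tauE -/q.
    rewrite (_ : _ - _ = z - m); last by rewrite /m; ring.
    by rewrite ler_norml; apply/andP; split; lra.
  rewrite ler_norml => /andP[? ?].
  have tau_bd : 2 <= tau <= P by apply/andP; split; lra.
  exists tau => //.
  have bt : base s k (b + tau * dl s k).
    by apply: base_convex bP => //; apply/andP; split; lra.
  by rewrite (lin_iso L bt jH) -/o tauE; ring.
have GF : F `&` ball y (w s k) `<=` ball y (w s k) `\` G.
  move=> z [Fz bz]; split => // /GP [tau tauP zE].
  have [n nH close] := return_close iH jH bb bP tauP.
  have := Fz n (leq_trans _ nH); rewrite zE xE ltNge => /(_ _)/negP; apply.
    exact: leq_trans kN (leq_H s k).
  apply: le_trans close _; rewrite mulrDl mul1r.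
  have -> : P * ((H s k)%:R * `|dl s k|) = e1 * ((H s k)%:R * w s k).
    by rewrite mulrCA PE; ring.
  have : e1 * ((H s k)%:R * w s k) <= e1 * 1 by rewrite ler_pM2l // tow_le1.
  have : (H s k)%:R * `|dl s k| <= (H s k)%:R * (e1 / 4 * w s k).
    by rewrite ler_wpM2l.
  have -> : (H s k)%:R * (e1 / 4 * w s k) = e1 * ((H s k)%:R * w s k) / 4 by field.
  lra.
have Gball : G `<=` ball y (w s k).
  move=> z /GP [tau /andP[tau2 tauP] ->]; rewrite /ball /= yE.
  have bt : base s k (b + tau * dl s k) by apply: base_convex bP => //; apply/andP; split; lra.
  rewrite (lin_iso L tb jH) (lin_iso L bt jH).
  move: tb bt; rewrite /base => /andP[? ?] /andP[? ?].
  by rewrite ltr_norml; apply/andP; split; lra.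
have := Hr0 _ wr0; rewrite ltNge => /negP; apply.
have mb : mu (ball y (w s k)) = (2 * w s k)%:E.
  by rewrite lebesgue_measure_ball ?ltW // mulr_natl.
have mG : mu G = (2 * q)%:E by exact: mu_itv_cc.
have mle : (mu (F `&` ball y (w s k)) <= (2 * w s k - 2 * q)%:E)%E.
  apply: (@le_trans _ _ (mu (ball y (w s k) `\` G))).
    apply: le_measure; rewrite ?inE //.
      by apply: measurableI => //; exact: measurable_ball.
    by apply: measurableD; [exact: measurable_ball|exact: measurable_itv].
  rewrite measureD /= -/mu; last 3 first.
  - exact: measurable_ball.
  - exact: measurable_itv.
  - by rewrite mb ltry.
  by rewrite setIidr // mb mG.
rewrite mb inver gt_eqF ?mulr_gt0 //.
apply: (@le_trans _ _ ((2 * w s k - 2 * q)%:E * ((2 * w s k)^-1)%:E)%E).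
  by apply: lee_wpmul2r => //; rewrite lee_fin invr_ge0 mulr_ge0 // ltW.
rewrite -EFinM lee_fin ler_pdivrMr ?mulr_gt0 // /q.
have -> : (P - 2) / 2 * `|dl s k| = (e1 * w s k) / 2 - `|dl s k|.
  by rewrite -PE; field.
lra.
Qed.

Lemma phi1_same s x : (exists2 e0 : R, 0 < e0 & has_room s e0 x) ->
  {ae mu, forall y, component s y -> phi1 T x y = 0%E}.
Proof.
move=> room.
have : \forall y \ae mu, forall m N : nat, component s y ->
    ~ orbit_avoids m.+1%:R^-1 N x y.
  apply: ae_foralln => m; apply: ae_foralln => N.
  by apply: ae_not_orbit_avoids; rewrite // invr_gt0.
apply: (@filterS _ _ (ae_filter_ringOfSetsType mu)) => y hy ys.
apply: limn_einf_eq0.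
  by move=> n; rewrite mulr_ge0.
move=> e N e0; apply: contrapT => no.
apply: (hy (Num.truncn e^-1) N ys) => n Nn; rewrite ltNge; apply/negP => le.
apply: no; exists n => //; apply: le_trans le _.
rewrite -[leRHS]invrK lef_pV2 ?posrE ?invr_gt0 //.
exact/ltW/truncnS_gt.
Qed.

Lemma inv_pow2_lt (e : R) : 0 < e -> exists K, forall k, (K <= k)%N ->
  1 / (2 ^ k)%:R < e.
Proof.
move=> e0; exists (Num.truncn e^-1).+1 => k Kk.
have p0 : 0 < (2 ^ k)%:R :> R by rewrite ltr0n expn_gt0.
rewrite ltr_pdivrMr // mulrC -ltr_pdivrMr // div1r.
apply: lt_le_trans (truncnS_gt _) _; rewrite ler_nat.
exact: leq_trans Kk (ltnW (ltn_expl _ _)).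
Qed.

Lemma comp_le s : (mu (component s) <= (1 / 2)%:E)%E.
Proof.
apply: measure_liminf_le; first exact: measurable_tow.
move=> K e e0; have [K' hK'] := inv_pow2_lt e0.
exists (maxn K K'); first exact: leq_maxl.
rewrite [X in (X <= _)%E]mu_tow lee_fin; apply: le_trans (tow_le _ _) _.
by rewrite lerD2l; apply/ltW/hK'; rewrite -addn2 (leq_trans (leq_maxr K K')) // leq_addr.
Qed.

Lemma comp01 s : component s `<=` `[0, 1[%classic.
Proof. by move=> x /comp_eventually [K h]; exact: tow01 (h K _). Qed.

Lemma ae_comp : {ae mu, forall x, 0 <= x < 1 -> exists s, component s x}.
Proof.
apply: (@filterS _ _ (ae_filter_ringOfSetsType mu) _ _ _ ae_typical) => x [K tx] x01.
by have [s h] := typical_comp x01 tx; exists s; apply/comp_eventually; exists K.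
Qed.

Lemma measure_le_ae (A B : set R) : measurable A -> measurable B ->
  {ae mu, forall x, A x -> B x} -> (mu A <= mu B)%E.
Proof.
move=> mA mB [N [mN N0 AN]].
apply: (@le_trans _ _ (mu (B `|` N))).
  apply: le_measure; rewrite ?inE //; first exact: measurableU.
  move=> x Ax; have [Bx|nBx] := pselect (B x); [by left|right].
  by apply: AN => /= /(_ Ax).
by apply: le_trans (measureU2 mu mB mN) _; rewrite [X in (_ + X <= _)%E]N0 adde0.
Qed.

(** Each component has measure at most 1/2 and together they cover almost all of [0, 1), so both
    bounds are attained. *)
Lemma mu_comp s : mu (component s) = (1 / 2)%:E.
Proof.
apply/eqP; rewrite eq_le comp_le /=.
have : (mu (`[0%R, 1%R[%classic : set R) <= mu (component s `|` component (~~ s)))%E.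
  apply: measure_le_ae => //.
    by apply: measurableU; exact: measurable_comp.
  apply: (@filterS _ _ (ae_filter_ringOfSetsType mu) _ _ _ ae_comp) => x h.
  rewrite /= in_itv /= => /h [s' xs'].
  by case: s s' xs' => -[]; [left|right|right|left].
move=> h; have : (1%:E <= mu (component s) + mu (component (~~ s)))%E.
  rewrite -mu_01; apply: le_trans h _.
  exact: (measureU2 mu (measurable_comp s) (measurable_comp (~~ s))).
have := comp_le (~~ s); have := measure_ge0 mu (component s).
have := comp_le s; have := measure_ge0 mu (component (~~ s)).
case: (mu (component s)) => [a| |] //; case: (mu (component (~~ s))) => [b| |] //.
by rewrite -EFinD !lee_fin => *; lra.
Qed.

Lemma ae_phi1 : {ae mu, forall x, 0 <= x < 1 -> exists s,
  {ae mu, forall y, 0 <= y < 1 ->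
    (component s y /\ phi1 T x y = 0%E) \/ (~ component s y /\ phi1 T x y = +oo%E)}}.
Proof.
have room : {ae mu, forall x, forall s, component s x ->
    exists2 e : R, 0 < e & has_room s e x}.
  apply: (@filterS2 _ _ (ae_filter_ringOfSetsType mu) _ _ _ _
    (ae_has_room true) (ae_has_room false)).
  by move=> x h1 h2 [].
apply: (@filterS2 _ _ (ae_filter_ringOfSetsType mu) _ _ _ _ ae_typical room).
move=> x [K tx] rx x01; have [s hs] := typical_comp x01 tx; exists s.
have xs : component s x by apply/comp_eventually; exists K.
apply: (@filterS2 _ _ (ae_filter_ringOfSetsType mu) _ _ _ _
  ae_typical (phi1_same (rx s xs))).
move=> y [K' ty] hy y01; have [s' hs'] := typical_comp y01 ty.
have ys' : component s' y by apply/comp_eventually; exists K'.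
have [ss'|ss'] := eqVneq s' s; first by left; subst s'; split => //; exact: hy.
right; split; first by move=> /(comp_disj ys') /eqP; rewrite (negPf ss').
apply: (@phi1_cross s) => //; [by exists K|by exists K'|].
by move: ys'; case: s s' ss' {hs hs' xs hy} => -[].
Qed.

(** At a late stage the uncovered part is too small to contain [[y], [y + r]), so some level of
    width below [e / 2] meets that interval; the orbit of [x] visits the base and then climbs to
    this level. *)
Lemma lineages_minimal : minimal_map T.
Proof.
move=> x y x01 y01 e e0.
pose r := Num.min (e / 2) (1 - y).
have r0 : 0 < r by case/andP: y01 => *; rewrite lt_min divr_gt0 //= subr_gt0.
have re : r <= e / 2 by rewrite ge_min lexx.
have ry : r <= 1 - y by rewrite ge_min lexx orbT.
have e2 : 0 < e / 2 by rewrite divr_gt0.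
have [K1 h1] := inv_pow2_lt r0.
have [K2 h2] := w_small false e2; have [K3 h3] := w_small true e2.
pose k := maxn K1 (maxn K2 K3).
have /and3P[k1 k2 k3] : [&& (K1 <= k)%N, (K2 <= k)%N & (K3 <= k)%N].
  by rewrite /k !leq_max !leqnn !orbT.
have [z zI [s zs]] : exists2 z, y <= z < y + r & exists s, tow s k z.
  apply: contrapT => no.
  suff : (mu (`[y, (y + r)%R[%classic : set R) <= mu (uncovered k))%E.
    rewrite mu_itv_co ?(ltW r0) // => h.
    have : (r%:E <= (1 / (2 ^ k.+1)%:R)%:E)%E := le_trans h (mu_uncovered k).
    rewrite lee_fin leNgt => /negP; apply.
    by apply: h1; exact: leqW.
  apply: le_measure; rewrite ?inE //; first exact: measurable_uncovered.
  move=> z /=; rewrite in_itv /= => zI; split.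
    by rewrite /= in_itv /=; case/andP: zI; case/andP: y01 => *; apply/andP; split; lra.
  by move=> [zt|zt]; apply: no; exists z => //; [exists false|exists true].
move: zs => /towP [i [b [iH bb zE]]].
have [t tb] := lin_visits L s k x01.
exists (i + t)%N; rewrite iterD (lin_iso L tb iH).
have wk : w s k < e / 2 by case: (s); [exact: h3|exact: h2].
move: zI; rewrite zE (lin_iso L bb iH); move: tb bb; rewrite /base.
move=> /andP[? ?] /andP[? ?] /andP[? ?].
by rewrite ltr_norml; apply/andP; split; lra.
Qed.

End Lineages.

(** * From iterated almost-everywhere statements to the product measure *)

Section Product.
Context {R : realType} (T : R -> R) (C : bool -> set R).
Local Notation mu := (@lebesgue_measure R).
Hypothesis mT : measurable_fun setT T.
Hypothesis C_half : forall s, mu (C s) = (1 / 2)%:E.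
Hypothesis mC : forall s, measurable (C s).
Hypothesis C01 : forall s, C s `<=` `[0, 1[%classic.
Hypothesis phiC : {ae mu, forall x, 0 <= x < 1 -> exists s,
  {ae mu, forall y, 0 <= y < 1 ->
    (C s y /\ phi1 T x y = 0%E) \/ (~ C s y /\ phi1 T x y = +oo%E)}}.

Lemma measurable_phi1 : measurable_fun setT (fun p : R * R => phi1 T p.1 p.2).
Proof.
have mu_n n : measurable_fun setT (fun p : R * R =>
    - (n%:R * `|iter n T p.1 - p.2|)%:E)%E; last first.
  rewrite (_ : (fun p => _) = -%E \o (fun p : R * R => limn_esup
    (fun n => - (n%:R * `|iter n T p.1 - p.2|)%:E)%E)) //.
  by apply: measurableT_comp => //; exact: measurable_fun_limn_esup mu_n.
apply: measurableT_comp => //; apply/measurable_EFinP.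
apply: measurable_funM => //.
apply: (measurableT_comp (@normr_measurable R setT)).
apply: measurable_funB => //.
have : measurable_fun setT (iter n T).
  by elim: n => [|n IH]; [exact: measurable_id | exact: (measurableT_comp mT IH)].
by move=> mTn; exact: (measurableT_comp mTn measurable_fst).
Qed.

Let measurable_phi1_pre (B : set (\bar R)) : measurable B ->
  measurable [set p : R * R | unit_square p /\ B (phi1 T p.1 p.2)].
Proof.
move=> mB.
have -> : [set p : R * R | unit_square p /\ B (phi1 T p.1 p.2)] =
    (`[0%R, 1%R[%classic `*` `[0%R, 1%R[%classic) `&`
    (setT `&` (fun p => phi1 T p.1 p.2) @^-1` B).
  apply/seteqP; rewrite setTI; split => -[x y] /=;
  by rewrite /unit_square /= !in_itv.
apply: measurableI; first by apply: measurableX; exact: measurable_itv.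
exact: measurable_phi1.
Qed.

Let xsecE (A : set (R * R)) x : xsection A x = [set y | A (x, y)].
Proof. by apply/seteqP; split => y /xsectionP. Qed.

(** The exceptional set is measurable and almost all its sections are null; the product measure
    integrates these sections. *)
Lemma phi1_dichotomy : {ae (mu \x mu)%E, forall p : R * R, unit_square p ->
  phi1 T p.1 p.2 = 0%E \/ phi1 T p.1 p.2 = +oo%E}.
Proof.
pose B := ~` ([set 0%E] `|` [set +oo%E]) : set (\bar R).
have mB : measurable B.
  by apply: measurableC; apply: measurableU; exact: emeasurable_set1.
exists [set p : R * R | unit_square p /\ B (phi1 T p.1 p.2)]; split.
- exact: measurable_phi1_pre.
- rewrite /product_measure1 /= (ae_eq_integral (cst 0%E)) ?integral0 //.
    by apply: measurable_fun_xsection; exact: measurable_phi1_pre.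
  apply: (@filterS _ _ (ae_filter_ringOfSetsType mu) _ _ _ phiC) => x h _ /=.
  have [x01|nx01] := pselect (0 <= x < 1); last first.
    rewrite xsecE (_ : [set y | _] = set0) ?measure0 //.
    by apply/seteqP; split => y //= -[[]].
  have [s hs] := h x01; apply/negligibleP.
    by apply: measurable_xsection; exact: measurable_phi1_pre.
  apply: negligibleS hs => y; rewrite xsecE /= => -[[_ y01] nB] /(_ y01) hy.
  by apply: nB; case: hy => -[_ ->]; [left|right].
- by move=> p /= /not_implyP [us no]; split => // hB; apply: no.
Qed.

(** For almost every [x] in [0, 1) the section is some [C s] up to a null set, of measure 1/2
    whichever [s] occurs. *)
Lemma measure_phi1_eq0 :
  (mu \x mu)%E [set p | unit_square p /\ phi1 T p.1 p.2 = 0%E] = (1 / 2)%:E.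
Proof.
pose Z := [set p : R * R | unit_square p /\ [set 0%E] (phi1 T p.1 p.2)].
have mZ : measurable Z by apply: measurable_phi1_pre; exact: emeasurable_set1.
rewrite -/Z /product_measure1 /=.
transitivity (\int[mu]_(x in `[0%R, 1%R[%classic) (cst (1 / 2)%:E) x)%E.
  rewrite [RHS]integral_mkcond; apply: ae_eq_integral => //.
  - exact: measurable_fun_xsection.
  - apply/(measurable_restrictT _ _).1 => //; exact: measurable_itv.
  apply: (@filterS _ _ (ae_filter_ringOfSetsType mu) _ _ _ phiC) => x h _ /=.
  rewrite patchE; case: ifPn => [|/negP]; rewrite inE /= in_itv /= => x01; last first.
    rewrite xsecE (_ : [set y | _] = set0) ?measure0 //.
    by apply/seteqP; split => y //= -[[]].
  have [s hs] := h x01; rewrite /= -(C_half s).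
  have mZx : measurable (xsection Z x) by exact: measurable_xsection.
  apply/eqP; rewrite eq_le; apply/andP; split; apply: measure_le_ae => //.
    apply: (@filterS _ _ (ae_filter_ringOfSetsType mu) _ _ _ hs) => y hy.
    rewrite xsecE /= => -[[_ /= y01] phi0].
    by case: (hy y01) => -[//]; rewrite phi0.
  apply: (@filterS _ _ (ae_filter_ringOfSetsType mu) _ _ _ hs) => y hy Cy.
  have y01 : 0 <= y < 1 by have := C01 Cy; rewrite /= in_itv.
  rewrite xsecE /=; split => //.
  by case: (hy y01) => -[].
rewrite integral_cst; last exact: measurable_itv.
by rewrite [X in (_ * X)%E]mu_01 mule1.
Qed.

End Product.

(** * Heights and lengths *)

Section Heights.
Local Open Scope nat_scope.

(** U and V refer to the second and third towers. [q] is the number of safe turns; the further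
    factor [growth] in [m] and [n] makes [q] steps of the drift a small part of the base. *)
Definition qU k (h : nat * nat * nat * nat) : nat :=
  let: (h1, h2, h3, h4) := h in growth k * (h3 + h1).
Definition mU k h : nat := growth k * qU k h.
Definition qV k (h : nat * nat * nat * nat) : nat :=
  let: (h1, h2, h3, h4) := h in growth k * (h2 + (mU k h * h2 + h1 + h4)).
Definition nV k h : nat := growth k * qV k h.

Fixpoint heights k : nat * nat * nat * nat :=
  if k is k'.+1 then
    let: (h1, h2, h3, h4) := heights k' in
    let m := mU k' (heights k') in let n := nV k' (heights k') in
    (m * h2 + h1 + (n.+1 * h3 + h4), m * h2 + h1 + (n * h3 + h4),
     m.+1 * h2 + h1, n.+1 * h3 + h4)
  else (1, 1, 1, 1).

Definition ht1 k : nat := (heights k).1.1.1.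
Definition ht2 k : nat := (heights k).1.1.2.
Definition ht3 k : nat := (heights k).1.2.
Definition ht4 k : nat := (heights k).2.
Definition dm k : nat := mU k (heights k).
Definition dn k : nat := nV k (heights k).

Lemma ht1S k : ht1 k.+1 = dm k * ht2 k + ht1 k + ((dn k).+1 * ht3 k + ht4 k).
Proof. by rewrite /dm /dn /ht1 /ht2 /ht3 /ht4 /=; case: (heights k) => -[[? ?] ?] ?. Qed.
Lemma ht2S k : ht2 k.+1 = dm k * ht2 k + ht1 k + (dn k * ht3 k + ht4 k).
Proof. by rewrite /dm /dn /ht1 /ht2 /ht3 /ht4 /=; case: (heights k) => -[[? ?] ?] ?. Qed.
Lemma ht3S k : ht3 k.+1 = (dm k).+1 * ht2 k + ht1 k.
Proof. by rewrite /dm /dn /ht1 /ht2 /ht3 /ht4 /=; case: (heights k) => -[[? ?] ?] ?. Qed.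
Lemma ht4S k : ht4 k.+1 = (dn k).+1 * ht3 k + ht4 k.
Proof. by rewrite /dm /dn /ht1 /ht2 /ht3 /ht4 /=; case: (heights k) => -[[? ?] ?] ?. Qed.

Definition stayU k : nat := growth k * (ht3 k + ht1 k).
Definition stayV k : nat := growth k * (ht2 k + (dm k * ht2 k + ht1 k + ht4 k)).

Lemma dmE k : dm k = growth k * stayU k.
Proof. by rewrite /dm /mU /stayU /qU /ht1 /ht3; case: (heights k) => -[[? ?] ?] ?. Qed.
Lemma dnE k : dn k = growth k * stayV k.
Proof.
rewrite /dn /nV /stayV /qV /dm /ht1 /ht2 /ht4.
by case: (heights k) => -[[? ?] ?] ?.
Qed.

Lemma hts_gt0 k : [/\ 0 < ht1 k, 0 < ht2 k, 0 < ht3 k & 0 < ht4 k].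
Proof.
elim: k => [|k [? ? ? ?]]; first by [].
by rewrite ht1S ht2S ht3S ht4S; split; lia.
Qed.

End Heights.

(** * Lengths compatible with all stages, as monotone limits *)

Section Lengths.
Context {R : realType}.
Implicit Types (u v : R * R * R * R) (k i : nat).

Definition area k : R := 1 / 2 - 1 / (2 ^ k.+2)%:R.

Definition expand k v : R * R * R * R :=
  let: (k1, k2, k3, k4) := v in
  (k1 + k2 + k3, (dm k)%:R * (k1 + k2 + k3) + k3,
   (dn k)%:R * (k1 + k2 + k4) + k1 + k4, k1 + k2 + k4).

(* [seed] has almost equal mass in the two long towers; as [area] increases fast
   enough, [seed k <= expand k (seed k.+1)], and [approx] is monotone in [i]. *)
Definition seed k : R * R * R * R :=
  (0, area k / (ht2 k)%:R, area k / (ht3 k)%:R, 0).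

Fixpoint approx i k : R * R * R * R :=
  if i is i'.+1 then expand k (approx i' k.+1) else seed k.

Definition le4 u v : Prop :=
  [/\ u.1.1.1 <= v.1.1.1, u.1.1.2 <= v.1.1.2, u.1.2 <= v.1.2 & u.2 <= v.2].

Definition mass k v : R :=
  (ht1 k)%:R * v.1.1.1 + (ht2 k)%:R * v.1.1.2 + (ht3 k)%:R * v.1.2 + (ht4 k)%:R * v.2.

Lemma expand_le4 k u v : le4 u v -> le4 (expand k u) (expand k v).
Proof.
move: u v => [[[u1 u2] u3] u4] [[[v1 v2] v3] v4] [/= a1 a2 a3 a4].
have A : (dm k)%:R * (u1 + u2 + u3) <= (dm k)%:R * (v1 + v2 + v3).
  by rewrite ler_wpM2l //; lra.
have B : (dn k)%:R * (u1 + u2 + u4) <= (dn k)%:R * (v1 + v2 + v4).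
  by rewrite ler_wpM2l //; lra.
by split => /=; lra.
Qed.

(** Heights evolve by the transpose of the matrix that [expand] applies to lengths, so the total
    tower area is preserved. *)
Lemma mass_expand k v : mass k (expand k v) = mass k.+1 v.
Proof.
move: v => [[[v1 v2] v3] v4]; rewrite /mass /= ht1S ht2S ht3S ht4S.
by rewrite !mulSn !natrD !natrM; ring.
Qed.

Lemma areaS k : area k.+1 - area k = 1 / (2 ^ k.+3)%:R.
Proof.
rewrite /area [(2 ^ k.+3)%N]expnS natrM.
have := pow2_ge1 (R := R) k.+2; set p := (_)%:R => ?.
by field; lra.
Qed.

Lemma area_ge k : 1 / 4 <= area k.
Proof.
rewrite /area expnSr natrM.
have p2 : 2 <= (2 ^ k.+1)%:R :> R.
  by have := pow2_ge1 (R := R) k; rewrite [(2 ^ k.+1)%N]expnS natrM; lra.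
suff : 1 / ((2 ^ k.+1)%:R * 2) <= 1 / 4 :> R by lra.
rewrite !div1r lef_pV2 ?posrE; lra.
Qed.

Lemma area_le k : area k <= 1 / 2.
Proof.
have : 0 <= 1 / (2 ^ k.+2)%:R :> R by rewrite divr_ge0.
rewrite /area; lra.
Qed.

Lemma area_step k (S N : nat) : (2 ^ k.+2 * S <= N)%N ->
  area k * (N + S)%:R <= area k.+1 * N%:R.
Proof.
move=> SN; rewrite natrD mulrDr.
have : area k * S%:R <= 1 / 2 * S%:R by rewrite ler_wpM2r // area_le.
suff : 1 / 2 * S%:R <= (area k.+1 - area k) * N%:R by lra.
rewrite areaS; have p0 : 0 < (2 ^ k.+3)%:R :> R by rewrite ltr0n expn_gt0.
have -> : 1 / (2 ^ k.+3)%:R * N%:R = N%:R / (2 ^ k.+3)%:R :> R by ring.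
rewrite ler_pdivlMr //; have : (2 ^ k.+2 * S)%:R <= N%:R :> R by rewrite ler_nat.
by rewrite [(2 ^ k.+3)%N]expnS !natrM; lra.
Qed.

Lemma growth2_ge k : (2 ^ k.+2 <= growth k * growth k)%N.
Proof.
have e : (2 ^ k.+2 <= 2 ^ k.+1 * 2 ^ k.+1)%N by rewrite -expnD leq_exp2l //; lia.
apply: leq_trans e (leq_mul _ _); rewrite /growth leq_exp2r //.
Qed.

Lemma ler_frac (a b x y D : R) : 0 < x -> 0 < y ->
  a * y <= b * (D * x) -> a / x <= D * (b / y).
Proof.
move=> x0 y0 h; have -> : D * (b / y) = b * D / y by ring.
by rewrite ler_pdivlMr // mulrAC ler_pdivrMr // -mulrA.
Qed.

(** Each new tall tower consists of [N] levels in turns around one old tower and [S] others;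
    [area_step] says that the increase of [area] pays for these [S] levels. *)
Lemma seed_le4 k : le4 (seed k) (expand k (seed k.+1)).
Proof.
have [h1 h2 h3 h4] := hts_gt0 k; have [h1' h2' h3' h4'] := hts_gt0 k.+1.
have H2 : 0 < (ht2 k)%:R :> R by rewrite ltr0n.
have H3 : 0 < (ht3 k)%:R :> R by rewrite ltr0n.
have H2' : 0 < (ht2 k.+1)%:R :> R by rewrite ltr0n.
have H3' : 0 < (ht3 k.+1)%:R :> R by rewrite ltr0n.
have a' := area_ge k.+1.
have A2 : 0 <= area k.+1 / (ht2 k.+1)%:R by rewrite divr_ge0 //; lra.
have A3 : 0 <= area k.+1 / (ht3 k.+1)%:R by rewrite divr_ge0 //; lra.
have g2 := growth2_ge k.
split => /=; rewrite ?add0r ?addr0 //; first by lra.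
- apply: (@le_trans _ _ (((dm k).+1)%:R * (area k.+1 / (ht3 k.+1)%:R))).
    apply: ler_frac => //; rewrite -natrM ht3S; apply: area_step.
    apply: (@leq_trans (growth k * growth k * ht1 k)).
      by rewrite leq_mul2r g2 orbT.
    apply: (@leq_trans (dm k)).
      by rewrite dmE /stayU -mulnA !leq_mul2l leq_addl !orbT.
    by apply: leq_trans (leq_pmulr _ h2); exact: leqnSn.
  have : 0 <= (dm k)%:R * (area k.+1 / (ht2 k.+1)%:R) by rewrite mulr_ge0.
  by rewrite -natr1 mulrDr mulrDl mul1r; lra.
- apply: (@le_trans _ _ ((dn k)%:R * (area k.+1 / (ht2 k.+1)%:R))); last by [].
  apply: ler_frac => //; rewrite -natrM ht2S.
  have -> : (dm k * ht2 k + ht1 k + (dn k * ht3 k + ht4 k) =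
    dn k * ht3 k + (dm k * ht2 k + ht1 k + ht4 k))%N by lia.
  apply: area_step.
  apply: (@leq_trans (growth k * growth k * (dm k * ht2 k + ht1 k + ht4 k))).
    by rewrite leq_mul2r g2 orbT.
  apply: leq_trans (leq_pmulr _ h3).
  by rewrite dnE /stayV -mulnA !leq_mul2l leq_addl !orbT.
Qed.

Lemma approx_le4 i k : le4 (approx i k) (approx i.+1 k).
Proof.
elim: i k => [|i IH] k; first exact: seed_le4.
exact: expand_le4 (IH k.+1).
Qed.

Lemma approx_mono i j k : (i <= j)%N -> le4 (approx i k) (approx j k).
Proof.
elim: j => [|j IH]; first by rewrite leqn0 => /eqP ->.
rewrite leq_eqVlt => /predU1P[->|]; first by split.
move=> /IH [a1 a2 a3 a4]; have [b1 b2 b3 b4] := approx_le4 j k.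
by split; [exact: le_trans b1|exact: le_trans b2|exact: le_trans b3|exact: le_trans b4].
Qed.

Lemma mass_approx i k : mass k (approx i k) = 2 * area (k + i).
Proof.
elim: i k => [|i IH] k; last by rewrite /= mass_expand IH addSnnS.
have [_ h2 h3 _] := hts_gt0 k.
rewrite /mass /= addn0 !mulr0 add0r addr0 ![_ * (_ / _)]mulrC !divfK ?pnatr_eq0 -?lt0n //.
by ring.
Qed.

Lemma approx_ge0 i k : le4 (0, 0, 0, 0) (approx i k).
Proof.
have [a1 a2 a3 a4] := approx_mono k (leq0n i).
have := area_ge k => a.
have A2 : 0 <= area k / (ht2 k)%:R by rewrite divr_ge0 //; lra.
have A3 : 0 <= area k / (ht3 k)%:R by rewrite divr_ge0 //; lra.
by split => //=; [exact: le_trans a2|exact: le_trans a3].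
Qed.

Lemma approx_le1 i k : le4 (approx i k) (1, 1, 1, 1).
Proof.
have [a1 a2 a3 a4] := approx_ge0 i k; have [h1 h2 h3 h4] := hts_gt0 k.
have M : mass k (approx i k) <= 1 by rewrite mass_approx; have := area_le (k + i); lra.
have B (h : nat) (x : R) : (0 < h)%N -> 0 <= x -> x <= h%:R * x.
  by move=> h0 x0; rewrite ler_peMl // ler1n.
have C (h : nat) (x : R) : 0 <= x -> 0 <= h%:R * x by move=> ?; rewrite mulr_ge0.
have := C (ht1 k) _ a1; have := C (ht2 k) _ a2; have := C (ht3 k) _ a3.
have := C (ht4 k) _ a4; have := B _ _ h1 a1; have := B _ _ h2 a2.
have := B _ _ h3 a3; have := B _ _ h4 a4.
by move: M; rewrite /mass => *; split => /=; lra.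
Qed.

(** The limits of [approx] inherit the linear relations; staying above [seed] gives the area bounds,
    and the mass [2 * area (k + i)] tends to 1. *)
Lemma exists_lengths : exists l1 l2 l3 l4 : nat -> R,
  [/\ forall k, refines (dm k) (dn k) (l1 k) (l2 k) (l3 k) (l4 k)
                  (l1 k.+1) (l2 k.+1) (l3 k.+1) (l4 k.+1),
      forall k, [/\ 0 < l1 k, 0 < l2 k, 0 < l3 k & 0 < l4 k],
      forall k, area k <= (ht2 k)%:R * l2 k,
      forall k, area k <= (ht3 k)%:R * l3 k &
      forall k, (ht1 k)%:R * l1 k + (ht2 k)%:R * l2 k +
        (ht3 k)%:R * l3 k + (ht4 k)%:R * l4 k = 1].
Proof.
have lim_of (p : R * R * R * R -> R) :
    (forall u v, le4 u v -> p u <= p v) -> p (1, 1, 1, 1) = 1 ->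
    forall k, exists l : R, (fun i => p (approx i k)) @ \oo --> l /\
      forall i, p (approx i k) <= l.
  move=> pm p1 k.
  have nd : nondecreasing_seq (fun i => p (approx i k)).
    by move=> i j ij; apply/pm/approx_mono.
  have cv : cvgn (fun i => p (approx i k)).
    apply: nondecreasing_is_cvgn => //; exists 1 => _ [i _ <-].
    by rewrite -p1; apply/pm/approx_le1.
  exists (limn (fun i => p (approx i k))); split; first exact: cv.
  by move=> i; exact: nondecreasing_cvgn_le.
have /choice [l1 L1] := lim_of (fun v => v.1.1.1) ltac:(by move=> u v []) erefl.
have /choice [l2 L2] := lim_of (fun v => v.1.1.2) ltac:(by move=> u v []) erefl.
have /choice [l3 L3] := lim_of (fun v => v.1.2) ltac:(by move=> u v []) erefl.
have /choice [l4 L4] := lim_of (fun v => v.2) ltac:(by move=> u v []) erefl.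
have eq_lim (u : nat -> R) (a b : R) : u @ \oo --> a -> (fun i => u i.+1) @ \oo --> b -> a = b.
  move=> ua ub; have ua' : (fun i => u i.+1) @ \oo --> a by rewrite cvg_shiftS.
  by rewrite -(cvg_lim (@Rhausdorff R) ua') -(cvg_lim (@Rhausdorff R) ub).
have appS i k : approx i.+1 k = let v := approx i k.+1 in
   (v.1.1.1 + v.1.1.2 + v.1.2, (dm k)%:R * (v.1.1.1 + v.1.1.2 + v.1.2) + v.1.2,
   (dn k)%:R * (v.1.1.1 + v.1.1.2 + v.2) + v.1.1.1 + v.2, v.1.1.1 + v.1.1.2 + v.2).
  by rewrite /=; case: (approx i k.+1) => -[[]].
have E1 k : l1 k = l1 k.+1 + l2 k.+1 + l3 k.+1.
  apply: eq_lim (L1 k).1 _; under eq_fun do rewrite appS /=.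
  by apply: cvgD; [apply: cvgD|]; [exact: (L1 _).1|exact: (L2 _).1|exact: (L3 _).1].
have E4 k : l4 k = l1 k.+1 + l2 k.+1 + l4 k.+1.
  apply: eq_lim (L4 k).1 _; under eq_fun do rewrite appS /=.
  by apply: cvgD; [apply: cvgD|]; [exact: (L1 _).1|exact: (L2 _).1|exact: (L4 _).1].
have E2 k : l2 k = (dm k)%:R * l1 k + l3 k.+1.
  apply: eq_lim (L2 k).1 _; under eq_fun do rewrite appS /=.
  rewrite E1; apply: cvgD; last exact: (L3 _).1; apply: cvgMr.
  by apply: cvgD; [apply: cvgD|]; [exact: (L1 _).1|exact: (L2 _).1|exact: (L3 _).1].
have E3 k : l3 k = (dn k)%:R * l4 k + l1 k.+1 + l4 k.+1.
  apply: eq_lim (L3 k).1 _; under eq_fun do rewrite appS /=.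
  rewrite E4; apply: cvgD; last exact: (L4 _).1; apply: cvgD; last exact: (L1 _).1.
  apply: cvgMr.
  by apply: cvgD; [apply: cvgD|]; [exact: (L1 _).1|exact: (L2 _).1|exact: (L4 _).1].
have G2 k : area k <= (ht2 k)%:R * l2 k.
  have [_ h2 _ _] := hts_gt0 k; have := (L2 k).2 0%N; rewrite /= ler_pdivrMr ?ltr0n //.
  by rewrite mulrC.
have G3 k : area k <= (ht3 k)%:R * l3 k.
  have [_ _ h3 _] := hts_gt0 k; have := (L3 k).2 0%N; rewrite /= ler_pdivrMr ?ltr0n //.
  by rewrite mulrC.
have P2 k : 0 < l2 k.
  have [_ h2 _ _] := hts_gt0 k; have := G2 k; have := area_ge k => *.
  by rewrite -(pmulr_rgt0 _ (_ : 0 < (ht2 k)%:R)) ?ltr0n //; lra.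
have P3 k : 0 < l3 k.
  have [_ _ h3 _] := hts_gt0 k; have := G3 k; have := area_ge k => *.
  by rewrite -(pmulr_rgt0 _ (_ : 0 < (ht3 k)%:R)) ?ltr0n //; lra.
have N1 k : 0 <= l1 k.
  by apply: le_trans ((L1 k).2 0%N); have [] := approx_ge0 0 k.
have N4 k : 0 <= l4 k.
  by apply: le_trans ((L4 k).2 0%N); have [] := approx_ge0 0 k.
have P1 k : 0 < l1 k.
  by rewrite E1; have := N1 k.+1; have := P2 k.+1; have := P3 k.+1; lra.
have P4 k : 0 < l4 k.
  by rewrite E4; have := N1 k.+1; have := P2 k.+1; have := N4 k.+1; lra.
exists l1, l2, l3, l4; split => // k.
apply/eqP; rewrite eq_le; apply/andP; split.
  have cv : (fun i => mass k (approx i k)) @ \oo --> (ht1 k)%:R * l1 k +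
      (ht2 k)%:R * l2 k + (ht3 k)%:R * l3 k + (ht4 k)%:R * l4 k.
    apply: cvgD; [apply: cvgD; [apply: cvgD|]|]; apply: cvgMr.
    - exact: (L1 _).1.
    - exact: (L2 _).1.
    - exact: (L3 _).1.
    - exact: (L4 _).1.
  rewrite -(cvg_lim _ cv) //; apply: limr_le; first by apply/cvg_ex; eexists; exact: cv.
  by apply: nearW => i; rewrite mass_approx; have := area_le (k + i); lra.
rewrite leNgt; apply/negP => lt1.
have [K hK] := inv_pow2_lt (e := 1 - ((ht1 k)%:R * l1 k +
      (ht2 k)%:R * l2 k + (ht3 k)%:R * l3 k + (ht4 k)%:R * l4 k)) ltac:(by rewrite subr_gt0).
have := hK (k + K).+1 ltac:(lia).
have : mass k (approx K k) <= (ht1 k)%:R * l1 k +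
      (ht2 k)%:R * l2 k + (ht3 k)%:R * l3 k + (ht4 k)%:R * l4 k.
  by rewrite /mass !lerD // ler_wpM2l //; [exact: (L1 k).2|exact: (L2 k).2|
    exact: (L3 k).2|exact: (L4 k).2].
rewrite mass_approx /area [(2 ^ (k + K).+2)%N]expnS natrM.
have := pow2_ge1 (R := R) (k + K).+1; set p := (_)%:R => p1.
have -> : 2 * (1 / 2 - 1 / (2 * p)) = 1 - 1 / p by field; lra.
lra.
Qed.

End Lengths.

(** * The interval exchange *)

Section Exchange2413.
Context {R : realType}.

(** Lists the position of each interval after the exchange, counted from 0; the bottom order is 2 4
    1 3. *)
Definition perm_fun (i : 'I_4) : 'I_4 :=
  nth ord0 [:: inord 2; inord 0; inord 3; inord 1] i.

Lemma perm_fun_inj : injective perm_fun.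
Proof.
have v i : val (perm_fun i) = nth 0%N [:: 2; 0; 3; 1]%N i.
  by case: i => -[|[|[|[|]]]] //= h; rewrite /perm_fun /= inordK.
move=> i j /(congr1 val); rewrite !v => h; apply: val_inj.
by case: i j h => -[|[|[|[|]]]] //= h [[|[|[|[|]]]]].
Qed.

Definition pi2413 : 'S_4 := perm perm_fun_inj.

Definition len4 (l1 l2 l3 l4 : R) (i : 'I_4) : R := nth 0 [:: l1; l2; l3; l4] i.

Lemma pi2413E i : val (pi2413 i) = nth 0%N [:: 2; 0; 3; 1]%N i.
Proof.
by rewrite permE; case: i => -[|[|[|[|]]]] //= h; rewrite /perm_fun /= inordK.
Qed.

Section Values.
Variables l1 l2 l3 l4 : R.
Let T := iet pi2413 (len4 l1 l2 l3 l4).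


Lemma sum_len4 (P : pred nat) : \sum_(i < 4 | P i) len4 l1 l2 l3 l4 i =
  (if P 0%N then l1 else 0) + (if P 1%N then l2 else 0) +
  (if P 2%N then l3 else 0) + (if P 3%N then l4 else 0).
Proof. by rewrite big_mkcond /= !big_ord_recl big_ord0 addr0 !addrA. Qed.

Lemma sum_pi2413 k : \sum_(i < 4 | (pi2413 i < k)%N) len4 l1 l2 l3 l4 i =
  (if (2 < k)%N then l1 else 0) + (if (0 < k)%N then l2 else 0) +
  (if (3 < k)%N then l3 else 0) + (if (1 < k)%N then l4 else 0).
Proof.
rewrite (eq_bigl (fun i : 'I_4 => (nth 0 [:: 2; 0; 3; 1] i < k)%N)).
  exact: (sum_len4 (fun i => (nth 0 [:: 2; 0; 3; 1] i < k)%N)).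
by move=> i; rewrite pi2413E.
Qed.

Lemma iet_sum x : T x = x +
  ((if (0 <= x) && (x < l1) then l2 + l4 else 0) +
   (if (l1 <= x) && (x < l1 + l2) then - l1 else 0) +
   (if (l1 + l2 <= x) && (x < l1 + l2 + l3) then l4 else 0) +
   (if (l1 + l2 + l3 <= x) && (x < l1 + l2 + l3 + l4) then - (l1 + l3) else 0)).
Proof.
rewrite /T /iet; congr (_ + _).
have sE k : iet_s (len4 l1 l2 l3 l4) k = (if (0 < k)%N then l1 else 0) +
    (if (1 < k)%N then l2 else 0) + (if (2 < k)%N then l3 else 0) +
    (if (3 < k)%N then l4 else 0).
  exact: (sum_len4 (fun i => (i < k)%N)).
rewrite !big_ord_recl big_ord0 !sE !sum_pi2413 !pi2413E /= ?addr0 ?add0r ?oppr0 ?addrA.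
by congr (_ + _ + _ + _); case: ifP => // _; ring.
Qed.

Hypothesis l_gt0 : [/\ 0 < l1, 0 < l2, 0 < l3 & 0 < l4].

Let below (x a b : R) : x < a -> (a <= x < b) = false.
Proof. by move=> xa; rewrite leNgt xa. Qed.
Let above (x a b : R) : b <= x -> (a <= x < b) = false.
Proof. by move=> bx; rewrite [x < b]ltNge bx andbF. Qed.

Lemma iet1 x : 0 <= x < l1 -> T x = x + (l2 + l4).
Proof.
case: l_gt0 => ? ? ? ? xI; rewrite iet_sum xI; case/andP: xI => ? ?.
by rewrite !below; lra.
Qed.

Lemma iet2 x : l1 <= x < l1 + l2 -> T x = x - l1.
Proof.
case: l_gt0 => ? ? ? ? xI; rewrite iet_sum xI; case/andP: xI => ? ?.
by rewrite (above 0) // !below; lra.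
Qed.

Lemma iet3 x : l1 + l2 <= x < l1 + l2 + l3 -> T x = x + l4.
Proof.
case: l_gt0 => ? ? ? ? xI; rewrite iet_sum xI; case/andP: xI => ? ?.
by rewrite (above 0) 1?(above l1) // ?below; lra.
Qed.

Lemma iet4 x : l1 + l2 + l3 <= x < l1 + l2 + l3 + l4 -> T x = x - (l1 + l3).
Proof.
case: l_gt0 => ? ? ? ? xI; rewrite iet_sum xI; case/andP: xI => ? ?.
by rewrite (above 0) 1?(above l1) 1?(above (l1 + l2)) //; lra.
Qed.

Hypothesis l_sum : l1 + l2 + l3 + l4 = 1.

Variant iet_spec x : R -> Prop :=
| IetSpec1 of 0 <= x & x < l1 : iet_spec x (x + (l2 + l4))
| IetSpec2 of l1 <= x & x < l1 + l2 : iet_spec x (x - l1)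
| IetSpec3 of l1 + l2 <= x & x < l1 + l2 + l3 : iet_spec x (x + l4)
| IetSpec4 of l1 + l2 + l3 <= x & x < 1 : iet_spec x (x - (l1 + l3)).

Lemma ietP x : 0 <= x < 1 -> iet_spec x (T x).
Proof.
move=> /andP[x0 x1].
have [?|?] := ltP x l1; first by rewrite iet1 ?x0 //; constructor.
have [?|?] := ltP x (l1 + l2); first by rewrite iet2; [constructor|apply/andP].
have [?|?] := ltP x (l1 + l2 + l3); first by rewrite iet3; [constructor|apply/andP].
by rewrite iet4 ?l_sum; [constructor|apply/andP].
Qed.

Lemma iet01 x : 0 <= x < 1 -> 0 <= T x < 1.
Proof.
have := l_sum; case: l_gt0 => ? ? ? ? ? /ietP [] ? ?; apply/andP; split; lra.
Qed.

Lemma iet_inj x y : 0 <= x < 1 -> 0 <= y < 1 -> T x = T y -> x = y.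
Proof.
have := l_sum; case: l_gt0 => ? ? ? ? ? /ietP [] ? ? /ietP [] ? ?; lra.
Qed.

Lemma stage0 : stage T 0 l1 l2 l3 l4 1 1 1 1.
Proof.
case: l_gt0 => ? ? ? ?.
have tower1 lo hi c w tau : (forall x, c <= x < c + w -> T x = x + tau) ->
    tower T lo hi c w 1 tau.
  move=> h x xI; split; first exact: h.
    move=> [|[|//]] _; first by rewrite /= !subrr.
    rewrite /= !h //; first by ring.
    by case/andP: xI => ? ?; apply/andP; split; lra.
  by move=> [|[|]].
split; apply: tower1 => x; rewrite ?add0r.
- exact: iet1.
- exact: iet2.
- exact: iet3.
- exact: iet4.
Qed.

Lemma measurable_iet : measurable_fun setT T.
Proof.
rewrite (_ : T = fun x : R => x +
  ((l2 + l4) * \1_`[0, l1[ x + (- l1) * \1_`[l1, l1 + l2[ x +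
   l4 * \1_`[l1 + l2, l1 + l2 + l3[ x +
   (- (l1 + l3)) * \1_`[l1 + l2 + l3, l1 + l2 + l3 + l4[ x)); last first.
  apply/funext => x; rewrite iet_sum !indicE.
  rewrite !mem_setE !in_itv /=.
  by congr (_ + (_ + _ + _ + _)); case: ifP => _; rewrite ?mulr1 ?mulr0.
apply: measurable_funD => //.
by repeat apply: measurable_funD; apply: measurable_funM => //;
  exact: measurable_indic.
Qed.

End Values.
End Exchange2413.

(** * The exchange carries two lineages *)

Section Realization.
Context {R : realType} (l1 l2 l3 l4 : nat -> R).
Hypothesis lR : forall k, refines (dm k) (dn k) (l1 k) (l2 k) (l3 k) (l4 k)
                  (l1 k.+1) (l2 k.+1) (l3 k.+1) (l4 k.+1).
Hypothesis l_gt0 : forall k, [/\ 0 < l1 k, 0 < l2 k, 0 < l3 k & 0 < l4 k].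
Hypothesis area2 : forall k, area k <= (ht2 k)%:R * l2 k.
Hypothesis area3 : forall k, area k <= (ht3 k)%:R * l3 k.
Hypothesis mass1 : forall k, (ht1 k)%:R * l1 k + (ht2 k)%:R * l2 k +
        (ht3 k)%:R * l3 k + (ht4 k)%:R * l4 k = 1.

Let T : R -> R := iet pi2413 (len4 (l1 0%N) (l2 0%N) (l3 0%N) (l4 0%N)).
Let a k : R := \sum_(j < k) l2 j.

Let aS k : a k.+1 = a k + l2 k.
Proof. by rewrite /a big_ord_recr. Qed.

Lemma total0 : l1 0%N + l2 0%N + l3 0%N + l4 0%N = 1.
Proof. by have := mass1 0; rewrite /ht1 /ht2 /ht3 /ht4 /= !mul1r. Qed.

Lemma dm_gt0 k : (0 < dm k)%N.
Proof.
have [? _ _ _] := hts_gt0 k.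
by rewrite dmE /stayU !muln_gt0 addn_gt0 !expn_gt0 /=; lia.
Qed.

Lemma dn_gt0 k : (0 < dn k)%N.
Proof.
have [_ ? _ _] := hts_gt0 k.
by rewrite dnE /stayV !muln_gt0 addn_gt0 !expn_gt0 /=; lia.
Qed.

Lemma stages k : stage T (a k) (l1 k) (l2 k) (l3 k) (l4 k)
  (ht1 k) (ht2 k) (ht3 k) (ht4 k).
Proof.
elim: k => [|k IH]; first by rewrite /a big_ord0; exact: stage0.
rewrite aS ht1S ht2S ht3S ht4S.
exact: stage_step (dm_gt0 k) (dn_gt0 k) (lR k) IH.
Qed.

Lemma ml_le k : (dm k)%:R * l1 k <= l2 k.
Proof. by case: (lR k) => -[? ? ? ?] _ -> _ _; lra. Qed.

Lemma nl_le k : (dn k)%:R * l4 k <= l3 k.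
Proof. by case: (lR k) => -[? ? ? ?] _ _ -> _; lra. Qed.

Lemma l1_le_l2 k : l1 k <= l2 k.
Proof.
apply: le_trans (ml_le k); have [? _ _ _] := l_gt0 k.
by rewrite ler_peMl ?ler1n ?dm_gt0 // ltW.
Qed.

Lemma l4_le_l3 k : l4 k <= l3 k.
Proof.
apply: le_trans (nl_le k); have [_ _ _ ?] := l_gt0 k.
by rewrite ler_peMl ?ler1n ?dn_gt0 // ltW.
Qed.

Let inJ k x := a k <= x < a k + (l1 k + l2 k + l3 k + l4 k).

Lemma inJ01 k x : inJ k x -> 0 <= x < 1.
Proof.
suff : 0 <= a k /\ a k + (l1 k + l2 k + l3 k + l4 k) <= 1.
  by move=> [? ?] /andP[? ?]; apply/andP; split; lra.
elim: k => [|k [IH1 IH2]]; first by rewrite /a big_ord0 total0 add0r.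
have [? ? ? ?] := l_gt0 k; rewrite aS; case: (lR k) => -[? ? ? ?] ? _ _ ?.
by split; lra.
Qed.

Lemma iter_T01 n x : 0 <= x < 1 -> 0 <= iter n T x < 1.
Proof.
by move=> x01; elim: n => //= n; apply: iet01 => //; exact: total0.
Qed.

Lemma iter_T_inj n x y : 0 <= x < 1 -> 0 <= y < 1 -> iter n T x = iter n T y -> x = y.
Proof.
move=> x01 y01; elim: n => //= n IH E; apply: IH.
by apply: iet_inj E => //; [exact: total0|exact: iter_T01|exact: iter_T01].
Qed.

(** * Visits of every orbit to every base *)

Lemma drift_left k x : a k + l1 k <= x < a k + l1 k + l2 k ->
  exists t, a k <= iter t T x < a k + l1 k.
Proof.
have [? ? ? ?] := l_gt0 k => xI.
have : x < a k + l1 k + (Num.truncn ((x - (a k + l1 k)) / l1 k)).+1%:R * l1 k.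
  by rewrite -ltrBlDl -ltr_pdivrMr // truncnS_gt.
move: (_.+1) xI => r; elim: r x => [|r IH] x xI xr.
  by case/andP: xI => *; lra.
have [_ st2 _ _] := stages k; have [E _ _] := st2 _ xI.
have [lo|hi] := ltP (x - l1 k) (a k + l1 k).
  by exists (ht2 k); rewrite E; case/andP: xI => *; apply/andP; split; lra.
have [||t tP] := IH (x - l1 k).
- by case/andP: xI => *; apply/andP; split; lra.
- by move: xr; rewrite -natr1; lra.
by exists (t + ht2 k)%N; rewrite iterD E.
Qed.

Lemma drift_right k x : a k + l1 k + l2 k <= x < a k + l1 k + l2 k + l3 k ->
  exists t, a k + l1 k + l2 k + l3 k <= iter t T x < a k + l1 k + l2 k + l3 k + l4 k.
Proof.
have [? ? ? ?] := l_gt0 k => xI.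
set b := a k + l1 k + l2 k + l3 k.
have : b < x + (Num.truncn ((b - x) / l4 k)).+1%:R * l4 k.
  by rewrite -ltrBlDl -ltr_pdivrMr // truncnS_gt.
move: (_.+1) xI => r; elim: r x => [|r IH] x xI xr.
  by move: xr; rewrite /b; case/andP: xI => *; lra.
have [_ _ st3 _] := stages k; have [E _ _] := st3 _ xI.
have [lo|hi] := ltP (x + l4 k) b; last first.
  by exists (ht3 k); rewrite E; move: hi; rewrite /b; case/andP: xI => *; apply/andP; split; lra.
have [||t tP] := IH (x + l4 k).
- by move: lo; rewrite /b; case/andP: xI => *; apply/andP; split; lra.
- by move: xr; rewrite -natr1; lra.
by exists (t + ht3 k)%N; rewrite iterD E.
Qed.

Lemma hit_from4 k x : a k + l1 k + l2 k + l3 k <= x < a k + l1 k + l2 k + l3 k + l4 k ->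
  exists t, inJ k.+1 (iter t T x).
Proof.
move=> xI; have [_ _ _ /(_ _ xI) [E _ _]] := stages k.
exists (ht4 k); rewrite E /inJ aS; case: (lR k) => -[? ? ? ?] ? _ _ ?.
by case/andP: xI => *; apply/andP; split; lra.
Qed.

Lemma hit_from3 k x : a k + l1 k + l2 k <= x < a k + l1 k + l2 k + l3 k ->
  exists t, inJ k.+1 (iter t T x).
Proof.
move=> /drift_right [t /hit_from4 [t' h]].
by exists (t' + t)%N; rewrite iterD.
Qed.

Lemma hit_from1 k x : a k <= x < a k + l1 k -> exists t, inJ k.+1 (iter t T x).
Proof.
move=> xI; have [/(_ _ xI) [E _ _] _ _ _] := stages k.
have [? ? ? ?] := l_gt0 k; case: (lR k) => -[? ? ? ?] ? _ _ ?.
have [lo|hi] := ltP (x + (l2 k + l4 k)) (a k.+1 + (l1 k.+1 + l2 k.+1 + l3 k.+1 + l4 k.+1)).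
  exists (ht1 k); rewrite E /inJ lo andbT aS.
  by case/andP: xI => *; lra.
have := l4_le_l3 k => ?.
have [|t h] := @hit_from3 k (x + (l2 k + l4 k)).
  by move: hi; rewrite aS; case/andP: xI => *; apply/andP; split; lra.
by exists (t + ht1 k)%N; rewrite iterD E.
Qed.

(** The second interval drifts into the first and the third into the fourth; the fourth lands in the
    next base, the first lands there or in the third. *)
Lemma hitS k x : inJ k x -> exists t, inJ k.+1 (iter t T x).
Proof.
rewrite /inJ => /andP[x0 x1].
have [c1|c1] := ltP x (a k + l1 k); first by apply: hit_from1; rewrite x0.
have [c2|c2] := ltP x (a k + l1 k + l2 k).
  have [|t /hit_from1 [t' h]] := @drift_left k x; first by rewrite c1.
  by exists (t' + t)%N; rewrite iterD.
have [c3|c3] := ltP x (a k + l1 k + l2 k + l3 k); first by apply: hit_from3; rewrite c2.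
by apply: hit_from4; rewrite c3 /=; lra.
Qed.

Lemma hit k x : 0 <= x < 1 -> exists t, inJ k (iter t T x).
Proof.
move=> x01; elim: k => [|k [t /hitS [t' h]]].
  by exists 0%N; rewrite /inJ /a big_ord0 total0 add0r.
by exists (t' + t)%N; rewrite iterD.
Qed.

(** The base of stage [k.+2] lies in the second and third intervals of stage [k.+1], hence in the
    second of stage [k]. To reach the third of stage [k], use [second_in_third] from the former, or
    drift into the fourth interval of stage [k.+1] from the latter. *)
Lemma visits k x : 0 <= x < 1 ->
  (exists t, a k + l1 k <= iter t T x < a k + l1 k + l2 k) /\
  (exists t, a k + l1 k + l2 k <= iter t T x < a k + l1 k + l2 k + l3 k).
Proof.
move=> /(hit k.+2) [t]; set y := iter t T x => yJ.
suff [[t2 h2] [t3 h3]] : (exists t, a k + l1 k <= iter t T y < a k + l1 k + l2 k) /\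
  (exists t, a k + l1 k + l2 k <= iter t T y < a k + l1 k + l2 k + l3 k).
  by split; [exists (t2 + t)%N|exists (t3 + t)%N]; rewrite iterD.
have st := stages k; have lk := lR k.
have [? ? ? ?] := l_gt0 k; case: (lR k) => -[? ? ? ?] ? _ _ ?.
have := l4_le_l3 k => ?; have := l1_le_l2 k => ?.
have := l4_le_l3 k.+1 => ?; have := l1_le_l2 k.+1 => ?.
have {yJ}/andP[y1 y2] : a k.+1 + l1 k.+1 <= y < a k.+1 + l1 k.+1 + l2 k.+1 + l3 k.+1.
  move: yJ; rewrite /inJ (aS k.+1); case: (lR k.+1) => -[? ? ? ?] ? _ _ ?.
  by move=> /andP[? ?]; apply/andP; split; lra.
split; first by exists 0%N => /=; move: y1 y2; rewrite aS => *; apply/andP; split; lra.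
have [yU|yV] := ltP y (a k.+1 + l1 k.+1 + l2 k.+1).
  exists (dm k * ht2 k + ht1 k + 0 * ht3 k)%N.
  apply: (second_in_third (dm_gt0 k) (dn_gt0 k) lk st); last exact: dn_gt0.
  by rewrite -aS y1.
have [|t3 h3] := @drift_right k.+1 y; first by rewrite yV.
by exists t3; move: h3; rewrite aS => /andP[? ?]; apply/andP; split; lra.
Qed.

(** The exclusive or records the swap: lineage [s] is the third tower when [s] differs from the
    parity of [k], and the second one otherwise. *)
Definition left_end s k : R :=
  if s (+) odd k then a k + l1 k + l2 k else a k + l1 k.
Definition width s k : R := if s (+) odd k then l3 k else l2 k.
Definition shift s k : R := if s (+) odd k then l4 k else - l1 k.
Definition tall s k : nat := if s (+) odd k then ht3 k else ht2 k.
Definition stay s k : nat := if s (+) odd k then stayV k else stayU k.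
Definition extra s k : nat :=
  if s (+) odd k then (dm k * ht2 k + ht1 k + ht4 k)%N else ht1 k.
Definition inner s k i : bool :=
  if s (+) odd k
  then (dm k * ht2 k + ht1 k <= i < dm k * ht2 k + ht1 k + dn k * ht3 k)%N
  else (i < (dm k).+1 * ht2 k)%N.

Lemma lineage_tower s k : tower T (a k) (a k + (l1 k + l2 k + l3 k + l4 k))
  (left_end s k) (width s k) (tall s k) (shift s k).
Proof.
have [_ t2 t3 _] := stages k.
by rewrite /left_end /width /tall /shift; case: (s (+) odd k).
Qed.

Lemma base_inJ s k x : left_end s k <= x < left_end s k + width s k -> inJ k x.
Proof.
have [? ? ? ?] := l_gt0 k; rewrite /left_end /width /inJ.
by case: (s (+) odd k) => /andP[? ?]; apply/andP; split; lra.
Qed.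

Lemma base_disj k s s' x : left_end s k <= x < left_end s k + width s k ->
  left_end s' k <= x < left_end s' k + width s' k -> s = s'.
Proof.
rewrite /left_end /width; case: s s' => -[] //=; case: (odd k) => /=;
by move=> /andP[? ?] /andP[? ?]; lra.
Qed.

(** Injectivity of [T] cancels the common iterates, leaving a base point that is an interior iterate
    of a tower; this contradicts first return unless the times agree. *)
Lemma levels_disj k s s' x x' i i' :
  left_end s k <= x < left_end s k + width s k ->
  left_end s' k <= x' < left_end s' k + width s' k ->
  (i < tall s k)%N -> (i' < tall s' k)%N ->
  iter i T x = iter i' T x' -> s = s' /\ i = i'.
Proof.
wlog ii' : s s' x x' i i' / (i <= i')%N => [wh|].
  case: (leqP i i') => [|/ltnW] h xb xb' iH iH' E; first exact: wh E.
  by have [-> ->] := wh _ _ _ _ _ _ h xb' xb iH' iH (esym E).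
move=> xb xb' iH iH' E.
have x01 := inJ01 (base_inJ xb); have x01' := inJ01 (base_inJ xb').
have Ex : x = iter (i' - i) T x'.
  apply: (@iter_T_inj i) => //; first exact: iter_T01.
  by rewrite -iterD subnKC.
have [i'i|ne] := posnP (i' - i)%N.
  rewrite i'i /= in Ex; subst x'; split; first exact: base_disj xb xb'.
  by apply/eqP; rewrite eqn_leq ii' -subn_eq0 i'i.
have [_ _ /(_ (i' - i)%N)] := lineage_tower xb'.
rewrite ne /= (leq_ltn_trans (leq_subr _ _) iH') -Ex => /(_ isT) /negP [].
exact: base_inJ xb.
Qed.

(** Divide the time, counted from entry into the old tower, by its height: the quotient counts turns
    and the remainder is the level. *)
Lemma inner_tow s k x i :
  left_end s k.+1 <= x < left_end s k.+1 + width s k.+1 ->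
  (i < tall s k.+1)%N -> inner s k i -> exists j y,
  [/\ (j < tall s k)%N, left_end s k <= y < left_end s k + width s k &
      iter i T x = iter j T y].
Proof.
have [_ h2 h3 _] := hts_gt0 k.
rewrite /left_end /width /tall /inner /= addbN aS; case: (s (+) odd k) => /=.
  move=> xI _ /andP[i1 i2].
  pose i0 := (i - (dm k * ht2 k + ht1 k))%N.
  exists (i0 %% ht3 k)%N, (iter (dm k * ht2 k + ht1 k + (i0 %/ ht3 k) * ht3 k) T x).
  split; first by rewrite ltn_mod.
    apply: (second_in_third (dm_gt0 k) (dn_gt0 k) (lR k) (stages k) xI).
    by rewrite ltn_divLR // /i0; lia.
  by rewrite -iterD; congr iter; have := divn_eq i0 (ht3 k); rewrite /i0; lia.
move=> xI _ iH.
exists (i %% ht2 k)%N, (iter (i %/ ht2 k * ht2 k) T x).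
split; first by rewrite ltn_mod.
  apply: (third_in_second (dm_gt0 k) (dn_gt0 k) (lR k) (stages k) xI).
  by rewrite -ltnS ltn_divLR.
by rewrite -iterD addnC -divn_eq.
Qed.

Lemma count_outside (A B N : nat) : (A <= B)%N -> (B <= N)%N ->
  count (fun i => ~~ ((A <= i) && (i < B))%N) (iota 0 N) = (A + (N - B))%N.
Proof.
move=> AB BN.
have -> : N = (A + ((B - A) + (N - B)))%N by lia.
rewrite !iotaD !count_cat add0n.
have -> : count (fun i => ~~ ((A <= i) && (i < B))%N) (iota 0 A) = A.
  rewrite -[RHS](size_iota 0 A); apply/eqP; rewrite -all_count; apply/allP => i.
  by rewrite mem_iota; lia.
have -> : count (fun i => ~~ ((A <= i) && (i < B))%N) (iota A (B - A)) = 0%N.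
  by apply/eqP; rewrite -leqn0 leqNgt -has_count; apply/hasPn => i; rewrite mem_iota; lia.
set n := (N - B)%N; rewrite add0n.
have -> : (A + (B - A + n) - B = n)%N by lia.
have -> : (A + (B - A) = B)%N by lia.
congr (_ + _)%N; rewrite -[RHS](size_iota B n); apply/eqP; rewrite -all_count.
by apply/allP => i; rewrite mem_iota; lia.
Qed.

Lemma realization : lineages T left_end width shift tall stay extra inner.
Proof.
split.
- by move=> x; apply: iet01 => //; exact: total0.
- by move=> s k x xb; exact: inJ01 (base_inJ xb).
- by move=> s k; have [? ? ? ?] := l_gt0 k; rewrite /width; case: (s (+) odd k).
- by move=> s k; have [? ? ? ?] := hts_gt0 k; rewrite /tall; case: (s (+) odd k).
- move=> s k; have [? ? ? ?] := hts_gt0 k; rewrite /stay /stayU /stayV.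
  by case: (s (+) odd k); rewrite muln_gt0 addn_gt0 expn_gt0 /=; lia.
- move=> s k x i xb iH; have [_ /(_ i (ltnW iH)) <- _] := lineage_tower xb.
  by ring.
- by move=> s k x xb; have [-> _ _] := lineage_tower xb.
- move=> s k; have [? ? ? ?] := l_gt0 k; rewrite /shift.
  by case: (s (+) odd k); rewrite ?oppr_eq0 gt_eqF.
- exact: levels_disj.
(* Here [growth * stay] is exactly [dn] or [dm], so the bound says that this many steps fit in the
   base. *)
- move=> s k; have [? ? ? ?] := l_gt0 k; rewrite /shift /stay /width.
  case: (s (+) odd k); rewrite -?dnE -?dmE ?normrN gtr0_norm // mulrC.
    exact: nl_le.
  exact: ml_le.
- by move=> s k; rewrite /tall /width; case: (s (+) odd k); [exact: area3|exact: area2].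
- exact: inner_tow.
- move=> s k; rewrite /inner /tall /extra /= addbN; case: (s (+) odd k) => /=.
    rewrite ht2S count_outside; lia.
  rewrite (@eq_count _ _ (fun i => ~~ ((0 <= i) && (i < (dm k).+1 * ht2 k))%N)) //.
  rewrite ht3S count_outside //; lia.
- move=> s k; have [? ? ? ?] := hts_gt0 k.
  rewrite /tall /extra /stay addNb; case: (s (+) odd k) => /=;
  by rewrite /stayU /stayV -mulnA leq_mul2l leq_pmulr ?orbT.
- move=> s k; rewrite /tall /stay /= addbN; case: (s (+) odd k) => /=.
    by rewrite mulnA -dnE ht2S; lia.
  by rewrite mulnA -dmE ht3S mulSn; lia.
- move=> x s k /(visits k) [v2 v3]; rewrite /left_end /width.
  by case: (s (+) odd k).
Qed.

End Realization.

Theorem theorem4p4 (R : realType) :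
  exists (pi : 'S_4) (l : 'I_4 -> R),
    iet_lengths l /\ minimal_map (iet pi l) /\
    exists b : R, 1/4 <= b <= 3/4 /\
      {ae ((@lebesgue_measure R) \x (@lebesgue_measure R))%E,
         forall p : R * R, unit_square p ->
           phi1 (iet pi l) p.1 p.2 = 0%E \/ phi1 (iet pi l) p.1 p.2 = +oo%E} /\
      ((@lebesgue_measure R) \x (@lebesgue_measure R))%E
         [set p | unit_square p /\ phi1 (iet pi l) p.1 p.2 = 0%E] = b%:E.
Proof.
have [l1 [l2 [l3 [l4 [lR l_gt0 area2 area3 mass1]]]]] := @exists_lengths R.
have [p1 p2 p3 p4] := l_gt0 0%N; have tot := total0 mass1.
exists pi2413, (len4 (l1 0%N) (l2 0%N) (l3 0%N) (l4 0%N)).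
have L := realization lR l_gt0 area2 area3 mass1.
have mT := measurable_iet (l1 0%N) (l2 0%N) (l3 0%N) (l4 0%N).
split; first split.
- by case=> -[|[|[|[|]]]] //= h; rewrite /len4.
- have := sum_len4 (l1 0%N) (l2 0%N) (l3 0%N) (l4 0%N) predT; rewrite /= => E.
  by rewrite -tot -E; apply: eq_bigl.
split; first exact: lineages_minimal L.
exists (1 / 2); split; first by apply/andP; split; lra.
split.
- apply: (phi1_dichotomy mT (ae_phi1 L)).
- apply: (measure_phi1_eq0 mT _ _ _ (ae_phi1 L)).
  + exact: mu_comp L.
  + exact: measurable_comp.
  + exact: comp01 L.
Qed.
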